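(* Let $(F,d_F)$ and $(G,d_G)$ be metric Fréchet spaces whose metrics are both of sum form. Let $U\subset F$ be open, $x_0\in U$, let $f:U\to G$ be b-smooth, and let $f'(x_0):F\to G$ be an isomorphism which is bounded from $0$. Then there is a real number $r_0>0$ such that $V:=f(B(x_0,r_0))$ is open in $G$ and $f|_{B(x_0,r_0)}:B(x_0,r_0)\to V$ is a diffeomorphism.
   Context: A Fréchet space is a locally convex topological vector space whose topology can be induced by a complete translation-invariant metric; a metric Fréchet space $(F,d_F)$ is a Fréchet space together with such a metric. $B(x_0,r_0)$ is the open $d_F$-ball of radius $r_0$ around $x_0$. Sum form: there are a countable family of continuous seminorms $\|\cdot\|_n$, $n\in\mathbb{N}$, whose balls form a basis of the topology, and a positive summable sequence $(\alpha_n)$, such that $d(x,y)=\sum_{n}\alpha_n\Phi(\|x-y\|_n)$, where $\Phi(t)=t/(1+t)$. A linear map $A:F\to G$ is bounded from $0$ if there is $c>0$ with $d_G(Av,0)\ge c\,d_F(v,0)$ for all $v\in F$. For vector spaces $F,H$ with translation-invariant metrics, $r\in(0,\infty]$ and a linear map $A:F\to H$, put $\langle A\rangle_r:=\sup_{0\neq p\in F,\ d_F(p,0)<r} d_H(Ap,0)/d_F(p,0)$; $B_r(F,H)$ is the set of linear $A$ with $\langle A\rangle_r<\infty$, with the metric $(A,B)\mapsto\langle A-B\rangle_r$. Put $B^{(1)}_r(F,G)=B_r(F,G)$ and $B_r^{(k+1)}(F,G)=B_r(F,B_r^{(k)}(F,G))$. A map $Q:U\to G$ on an open set $U\subset F$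 is differentiable at $p$ if there is a linear map $dQ(p)=Q'(p):F\to G$ with $dQ(p)v=\lim_{t\to0}(Q(p+tv)-Q(p))/t$ for all $v\in F$. Put $Q^{(1)}(u,v)=dQ(u)v$ and inductively $Q^{(k+1)}(u,f_1,\dots,f_{k+1})=\frac{d}{dt}\big|_{t=0}Q^{(k)}(u+tf_{k+1},f_1,\dots,f_k)$. $Q\in K^i(U,G)$ means that $Q^{(k)}:U\times F^k\to G$ exists and is continuous for all $k\le i$; $Q$ is smooth if $Q\in K^i(U,G)$ for all $i$; a diffeomorphism is a smooth bijection with smooth inverse. $Q$ is b-smooth (of radius $r$, for some $r\in(0,\infty]$) if it is smooth and for all $k\ge1$ the map sending $u\in U$ to the iterated linear map $f_1\mapsto(f_2\mapsto\cdots\mapsto Q^{(k)}(u,f_1,\dots,f_k))$ takes values in $B_r^{(k)}(F,G)$ and is continuous as a map $U\to B_r^{(k)}(F,G)$. *)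

(* Defs.v *)
From mathcomp Require Import all_boot all_order all_algebra.
From mathcomp Require Import all_classical all_reals all_analysis.

Set Implicit Arguments.
Unset Strict Implicit.
Unset Printing Implicit Defensive.

Import Order.TTheory GRing.Theory Num.Theory.
Import numFieldNormedType.Exports.

Local Open Scope classical_set_scope.
Local Open Scope ring_scope.

Section FrechetMetric.
Context {R : realType} {E : tvsType R}.
Implicit Type d : E -> E -> R.

Definition is_metric d : Prop :=
  [/\ forall x y, 0 <= d x y,
      forall x y, d x y = 0 <-> x = y,
      forall x y, d x y = d y x
    & forall x y z, d x z <= d x y + d y z].

Definition translation_invariant d : Prop :=
  forall x y z, d (x + z) (y + z) = d x y.

Definition induces_topology d : Prop :=
  forall x, nbhs x = filter_from [set e | 0 < e] (fun e => [set y | d x y < e]).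

(* The library's completeType is about the uniformity carried by E, which a
   tvsType does not force to be the one of d. *)
Definition complete_metric d : Prop :=
  forall u : nat -> E,
    (forall e : R, 0 < e -> exists N : nat, forall m n : nat,
       (N <= m)%N -> (N <= n)%N -> d (u m) (u n) < e) ->
    exists l : E, u @ \oo --> l.

End FrechetMetric.

(* A tvsType is locally convex by definition. *)
Record metricFrechet (R : realType) := MetricFrechet {
  mf_space :> tvsType R;
  mf_dist : mf_space -> mf_space -> R;
  mf_metric : is_metric mf_dist;
  mf_translation : translation_invariant mf_dist;
  mf_topology : induces_topology mf_dist;
  mf_complete : complete_metric mf_dist }.

Definition mf_ball {R : realType} (F : metricFrechet R) (x : F) (r : R) :
  set F := [set y | mf_dist x y < r].

Section SumForm.
Context {R : realType}.

Definition seminorm (E : lmodType R) (p : E -> R) : Prop :=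
  [/\ forall x, 0 <= p x,
      forall x y, p (x + y) <= p x + p y
    & forall (a : R) x, p (a *: x) = `|a| * p x].

Definition Phi (t : R) : R := t / (1 + t).

Definition sum_form (F : metricFrechet R) : Prop :=
  exists (nrm : nat -> F -> R) (alpha : nat -> R),
    [/\ forall n, seminorm (nrm n) /\ continuous (nrm n),
        basis [set B : set F | exists n (x : F) (e : R),
                 0 < e /\ B = [set y | nrm n (y - x) < e]],
        forall n, 0 < alpha n,
        cvgn (series alpha)
      & forall x y : F,
          series (fun n => alpha n * Phi (nrm n (x - y))) @ \oo
            --> mf_dist x y].

End SumForm.

Section LinearMaps.
Context {R : realType} {F G : metricFrechet R}.
Implicit Types A : F -> G.

Definition bounded_from_0 A : Prop :=
  exists2 c : R, 0 < c & forall v, c * mf_dist v 0 <= mf_dist (A v) 0.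

Definition frechet_isomorphism A : Prop :=
  [/\ linear A, continuous A
    & exists B : G -> F, [/\ cancel A B, cancel B A & continuous B]].

End LinearMaps.

Section BoundedMaps.
Context {R : realType}.

(* A vector space with a metric, presented as a subset of an ambient vector
   space; [ms_dist] is only meaningful on [ms_carrier]. *)
Record metricSubspace := MetricSubspace {
  ms_ambient : lmodType R;
  ms_carrier : set ms_ambient;
  ms_dist : ms_ambient -> ms_ambient -> R }.

Definition full_space (G : metricFrechet R) : metricSubspace :=
  @MetricSubspace G setT (fun x y => mf_dist x y).

Context {F : metricFrechet R}.
Implicit Types (r : \bar R) (H : metricSubspace).

(* The [maxe 0] makes the supremum of the empty set (case F = 0) equal to 0. *)
Definition bracket r H (A : F -> ms_ambient H) : \bar R :=
  maxe 0%E (ereal_sup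
    [set (ms_dist (A p) 0 / mf_dist p 0)%:E
      | p in [set p : F | p != 0 /\ ((mf_dist p 0)%:E < r)%E]]).

Definition Bspace r H : metricSubspace :=
  @MetricSubspace (F -> ms_ambient H)
    [set A | [/\ linear A, forall p, ms_carrier (A p)
               & (bracket r A < +oo)%E]]
    (fun A B => fine (bracket r (A - B))).

Definition Bspace_iter (G : metricFrechet R) r k : metricSubspace :=
  iter k (Bspace r) (full_space G).

Definition fcons k (x : F) (h : 'I_k -> F) : 'I_k.+1 -> F :=
  fun i => if unlift ord0 i is Some j then h j else x.

Fixpoint curry_iter (G : metricFrechet R) r k :
    (('I_k -> F) -> G) -> ms_ambient (Bspace_iter G r k) :=
  match k with
  | 0 => fun g => g (fun=> 0)
  | k'.+1 => fun g f1 => curry_iter r (fun h => g (fcons f1 h))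
  end.

End BoundedMaps.

Section Differentiation.
Context {R : realType} {F G : metricFrechet R}.
Implicit Types (Q : F -> G) (U : set F).

(* The library's [derive] and [derivable] are restricted to normed modules. *)
Definition diff_quotient Q (p v : F) : R -> G :=
  fun t => t^-1 *: (Q (p + t *: v) - Q p).

Definition Dderivable Q (p v : F) : Prop :=
  exists l : G, diff_quotient Q p v @ 0^' --> l.

(* The limit of the difference quotient if it exists, and 0 otherwise. *)
Definition Dderive Q (p v : F) : G :=
  xget 0 [set l : G | diff_quotient Q p v @ 0^' --> l].

Definition Ddifferentiable Q p : Prop :=
  (forall v, Dderivable Q p v) /\ linear (Dderive Q p).

(* Q^(k)(u, f_1, ..., f_k), with f_i = h (i - 1). *)
Fixpoint Dn Q k (u : F) : ('I_k -> F) -> G :=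
  match k with
  | 0 => fun=> Q u
  | k'.+1 => fun h =>
      Dderive (fun w => Dn Q w (h \o widen_ord (leqnSn k'))) u (h ord_max)
  end.

(* Given that Q^(j) exists on U for j < k, existence of Q^(k) on U. *)
Definition Dn_exists U Q k : Prop :=
  match k with
  | 0 => True
  | 1 => forall u, U u -> Ddifferentiable Q u
  | k'.+1 => forall u, U u -> forall (h : 'I_k' -> F) v,
      Dderivable (fun w => Dn Q w h) u v
  end.

Definition Kclass U i Q : Prop := forall k, (k <= i)%N ->
  Dn_exists U Q k /\
  {within [set z | U z.1],
     continuous (fun z : F * {ptws 'I_k -> F} => Dn Q z.1 z.2)}.

Definition smooth U Q : Prop := forall i, Kclass U i Q.

Definition Dn_linear Q r k (u : F) : ms_ambient (Bspace_iter (F := F) G r k) :=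
  curry_iter r (Dn Q u).

Definition bsmooth_radius r U Q : Prop :=
  smooth U Q /\ forall k, (0 < k)%N ->
    (forall u, U u -> ms_carrier (Dn_linear Q r k u)) /\
    (forall u, U u ->
       ms_dist (Dn_linear Q r k v) (Dn_linear Q r k u)
         @[v --> within U (nbhs u)] --> (0 : R)).

Definition bsmooth U Q : Prop :=
  exists2 r : \bar R, (0 < r)%E & bsmooth_radius r U Q.

End Differentiation.

(* A map defined on A only is represented by a total map, of which only the
   values on A matter. *)
Definition diffeomorphism {R : realType} {F G : metricFrechet R}
    (A : set F) (B : set G) (f : F -> G) : Prop :=
  [/\ set_bij A B f, smooth A f
    & exists2 g : G -> F, {in A, cancel f g} & smooth B g].

(* Main.v *)
Require Import Defs.
From mathcomp Require Import all_boot all_order all_algebra.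
From mathcomp Require Import all_classical all_reals all_analysis.
From mathcomp Require Import ring lra.

Set Implicit Arguments.
Unset Strict Implicit.
Unset Printing Implicit Defensive.

Import Order.TTheory GRing.Theory Num.Theory.
Import numFieldNormedType.Exports.

Local Open Scope classical_set_scope.
Local Open Scope ring_scope.

(** Composing [f] with the inverse of [f'(x0)] gives a map [phi] of [F] into
itself whose derivative at [x0] is the identity. Since [f'(x0)] is bounded from
0, the estimates that [bsmooth] provides for the first two derivatives of [f]
pass to [phi]: near [x0], and for vectors of size less than [r],

  d(phi'(x) q - q) <= d(q) / 2   and   d(phi''(x)(q, v)) <= C d(q) d(v).

A metric of sum form is not homogeneous and its balls need not be convex, so
that neither estimate can be integrated: mean value inequalities hold for
seminorms only. Each estimate is used in its own way.

- The second one becomes an estimate in seminorms by scaling. Fix a continuous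
  seminorm [bar] whose unit ball consists of vectors of size less than [r]. For
  a vector [v] and a continuous seminorm [q] there is [l > 0] so small that
  [C r d(l v)] lies below the threshold where [q] reaches 1, and then
  homogeneity gives [q (phi''(u)(w, v)) <= l^-1 bar w] for all [w], uniformly in
  [u]. Whatever [q] is, the right-hand side is measured in the same seminorm
  [bar]: there is no loss in [w], only a constant depending on [v]. This is the
  predicate [gain]. On sets where [x - x0] gains uniformly it makes
  [phi - id] Lipschitz from [bar] to every seminorm ([comparison]); as [phi - id]
  also halves [bar], the seminorms of [x - y] are bounded by those of
  [phi x - phi y] ([seminorm_comparison]), whence injectivity.

- The first one solves the linear equation [phi'(x) v = y] by a Neumann series
  that converges in the metric, with [d(l v) <= 2 d(l y)] for all [l] in [0, 1]
  ([phi1_solve_small]). By the scaling argument all these solutions, for all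
  [x], gain with the same constants, which depend on [y] alone
  ([gain_dominated]).

For surjectivity a fixed point iteration would lose control of the higher
seminorms at every step. Instead one follows the differential equation
[x' = phi'(x)^-1 y] from [z0] during the time 1, by Euler polygons. Their steps
are solutions as above, so they stay bounded in every seminorm and the images of
their end points miss [phi z0 + y] by [O(1/n)] in every seminorm. By
[seminorm_comparison] the end points form a Cauchy sequence, and the limit is a
preimage of [phi z0 + y] ([local_surjectivity]). The same estimates show that
the inverse map [g] is differentiable with derivative [f'(g y)^-1]
([inverse_derivative]).

Differentiating further, every derivative of [g] is [f'(g y)^-1] applied to an
expression built from the directions, the derivatives of [f] at [g y] and
[f'(g y)^-1]. These expressions are continuous and closed under differentiation
([expr_cvg], [expr_derivative]), so [g] is smooth ([smooth_inverse]). *)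

(** * Convergence by the metric and by seminorms *)

Section MetricSize.
Context {R : realType} {F : metricFrechet R}.
Implicit Types x y v l : F.

Definition msize (v : F) : R := mf_dist v 0.

Lemma mf_dist_msize x y : mf_dist x y = msize (x - y).
Proof. by rewrite /msize -(mf_translation x y (- y)) subrr. Qed.

Lemma msize_ge0 v : 0 <= msize v.
Proof. by have [+ _ _ _] := mf_metric F; apply. Qed.

Lemma msize0 : msize 0 = 0 :> R.
Proof. by have [_ /(_ 0 0) [_ h] _ _] := mf_metric F; exact: h. Qed.

Lemma msize_eq0 v : msize v = 0 -> v = 0.
Proof. by have [_ /(_ v 0) [+ _] _ _] := mf_metric F. Qed.

Lemma msizeN v : msize (- v) = msize v.
Proof.
have [_ _ sym _] := mf_metric F.
by rewrite {2}/msize sym mf_dist_msize sub0r.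
Qed.

Lemma msizeD v x : msize (v + x) <= msize v + msize x.
Proof.
have [_ _ _ /(_ v 0 (- x))] := mf_metric F.
by rewrite !mf_dist_msize !opprK subr0 add0r.
Qed.

Lemma msizeBC x y : msize (x - y) = msize (y - x).
Proof. by rewrite -msizeN opprB. Qed.

Lemma nbhs_msizeP x (A : set F) :
  nbhs x A <-> exists2 e, 0 < e & forall y, msize (y - x) < e -> A y.
Proof.
rewrite mf_topology; split => -[e e0 H]; exists e => // y.
  by rewrite msizeBC -mf_dist_msize; exact: H.
by rewrite /= mf_dist_msize msizeBC; exact: H.
Qed.

Lemma cvg_msizeP {S : Type} (Fl : set_system S) {FF : Filter Fl} (X : S -> F) l :
  X @ Fl --> l <->
  forall e, 0 < e -> \forall s \near Fl, msize (X s - l) < e.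
Proof.
split=> [H e e0|H A /nbhs_msizeP [e e0 eA]].
  by apply: (H [set y | msize (y - l) < e]); apply/nbhs_msizeP; exists e.
by apply: filterS (H e e0) => s /eA.
Qed.

Lemma cvg_msize_unique {S : Type} (Fl : set_system S) {FF : ProperFilter Fl}
    (X : S -> F) (l l' : F) : X @ Fl --> l -> X @ Fl --> l' -> l = l'.
Proof.
move=> /cvg_msizeP H /cvg_msizeP H'; apply/eqP; rewrite -subr_eq0; apply/eqP.
apply: msize_eq0; apply/eqP; rewrite eq_le msize_ge0 andbT leNgt.
apply/negP => e0; have e20 : 0 < msize (l - l') / 2 by rewrite divr_gt0.
have [s [Hs Hs']] := filter_ex (filterI (H _ e20) (H' _ e20)).
have := msizeD (l - X s) (X s - l'); rewrite subrKA msizeBC; lra.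
Qed.

(** The countable families of seminorms that define the topology. Balls of
single members suffice, as in [sum_form]. *)
Definition grading (p : nat -> F -> R) :=
  [/\ forall m, seminorm (p m),
      forall m e, 0 < e -> exists2 eta, 0 < eta & forall v, msize v < eta -> p m v < e
    & forall eta, 0 < eta ->
        exists m, exists2 e, 0 < e & forall v, p m v < e -> msize v < eta].

Definition cseminorm (p : F -> R) :=
  seminorm p /\
  forall e, 0 < e -> exists2 eta, 0 < eta & forall v, msize v < eta -> p v < e.

Section Seminorm.
Variables (p : F -> R).
Hypothesis sp : seminorm p.

Lemma snorm_ge0 v : 0 <= p v. Proof. by case: sp => + _ _; apply. Qed.

Lemma snormD v x : p (v + x) <= p v + p x. Proof. by case: sp => _ + _; apply. Qed.

Lemma snormZ a v : p (a *: v) = `|a| * p v. Proof. by case: sp => _ _; apply. Qed.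

Lemma snorm0 : p 0 = 0. Proof. by rewrite -(scale0r 0) snormZ normr0 mul0r. Qed.

Lemma snormN v : p (- v) = p v.
Proof. by rewrite -scaleN1r snormZ normrN1 mul1r. Qed.

Lemma snormBC v x : p (v - x) = p (x - v).
Proof. by rewrite -snormN opprB. Qed.

Lemma snormB v x : p (v - x) <= p v + p x.
Proof. by rewrite (le_trans (snormD _ _))// snormN. Qed.

Lemma snorm_trans x y z : p (x - z) <= p (x - y) + p (y - z).
Proof. by rewrite -[x - z](subrKA y) snormD. Qed.

Lemma snormZ_ge0 a v : 0 <= a -> p (a *: v) = a * p v.
Proof. by move=> a0; rewrite snormZ ger0_norm. Qed.

Lemma seminorm_scale a : 0 <= a -> seminorm (fun v => a * p v).
Proof.
move=> a0; split=> [v|v x|b v]; first by rewrite mulr_ge0// snorm_ge0.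
  by rewrite -mulrDr ler_wpM2l// snormD.
by rewrite snormZ mulrCA.
Qed.

End Seminorm.

Lemma grading_cseminorm p m : grading p -> cseminorm (p m).
Proof. by move=> [H1 H2 _]; split => //; exact: H2. Qed.

Lemma cseminorm_scale p a : 0 < a -> cseminorm p -> cseminorm (fun v => a * p v).
Proof.
move=> a0 [sp cp]; split; first by apply: seminorm_scale => //; exact: ltW.
move=> e e0; have [eta eta0 H] := cp (e / a) (divr_gt0 e0 a0).
by exists eta => // v /H; rewrite ltr_pdivlMr// mulrC.
Qed.

Section Grading.
Variable (p : nat -> F -> R).
Hypothesis gp : grading p.

Let sp m : seminorm (p m). Proof. by case: gp => + _ _; apply. Qed.

Lemma grading_cvgP {S : Type} (Fl : set_system S) {FF : Filter Fl}
    (X : S -> F) l : X @ Fl --> l <->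
  forall m e, 0 < e -> \forall s \near Fl, p m (X s - l) < e.
Proof.
case: gp => _ H2 H3; split=> [/cvg_msizeP H m e e0|H].
  by have [eta eta0 K] := H2 m e e0; apply: filterS (H _ eta0) => s /K.
apply/cvg_msizeP => e e0; have [m [e' e'0 K]] := H3 e e0.
by apply: filterS (H m e' e'0) => s /K.
Qed.

Lemma grading_eq0 v : (forall m, p m v = 0) -> v = 0.
Proof.
case: gp => _ _ H3 H; apply: msize_eq0; apply/eqP; rewrite eq_le msize_ge0 andbT.
rewrite leNgt; apply/negP => /H3 [m [e e0 K]].
by have := K v; rewrite H ltxx => /(_ e0).
Qed.

Lemma msize_scale_small v (eta : R) : 0 < eta ->
  exists l : R, [/\ 0 < l, l <= 1 & msize (l *: v) < eta].
Proof.
case: gp => _ _ H3 /H3 [m [e e0 K]].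
have pv := snorm_ge0 (sp m) v.
have D : 0 < e + p m v by rewrite ltr_wpDr.
exists (e / (e + p m v)); split; first exact: divr_gt0.
  by rewrite ler_pdivrMr// mul1r lerDl.
have ep : 0 <= e / (e + p m v) by rewrite divr_ge0 ?ltW.
apply: K; rewrite (snormZ_ge0 (sp m))// mulrAC ltr_pdivrMr//; nra.
Qed.

Lemma msize_scale_cvg0 (l eta : R) : 0 < eta ->
  exists2 delta, 0 < delta & forall v, msize v < delta -> msize (l *: v) < eta.
Proof.
case: (gp) => _ H2 H3 /H3 [m [e e0 K]].
have l0 : 0 < `|l| + 1 by rewrite ltr_wpDl.
have [delta delta0 D] := H2 m (e / (`|l| + 1)) (divr_gt0 e0 l0).
exists delta => // v /D; rewrite ltr_pdivlMr// => Hv.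
apply: K; rewrite (snormZ (sp m)); have := snorm_ge0 (sp m) v; nra.
Qed.

Lemma grading_complete (u : nat -> F) :
  (forall m e, 0 < e -> exists N : nat, forall i j : nat,
     (N <= i)%N -> (N <= j)%N -> p m (u i - u j) < e) ->
  exists l : F, u @ \oo --> l.
Proof.
move=> H; apply: mf_complete => e e0; case: gp => _ _ /(_ e e0) [m [e' e'0 K]].
have [N HN] := H m e' e'0; exists N => i j Ni Nj.
by rewrite mf_dist_msize; apply: K; exact: HN.
Qed.

Lemma cvg_sub0P {S : Type} (Fl : set_system S) {FF : Filter Fl} (X : S -> F) l :
  X @ Fl --> l <-> (fun s => X s - l) @ Fl --> (0 : F).
Proof.
split=> /grading_cvgP H; apply/grading_cvgP => m e e0; apply: filterS (H m e e0) => s;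
by rewrite subr0.
Qed.

End Grading.

End MetricSize.

Section CvgLinear.
Context {R : realType} {F : metricFrechet R} {S : Type} (Fl : set_system S).
Context {FF : Filter Fl}.
Implicit Types (X Y : S -> F) (a b : F).

Lemma mcvgD X Y a b : X @ Fl --> a -> Y @ Fl --> b ->
  (fun s => X s + Y s) @ Fl --> a + b.
Proof.
move=> /cvg_msizeP HX /cvg_msizeP HY; apply/cvg_msizeP => e e0.
have e20 : 0 < e / 2 by rewrite divr_gt0.
apply: filterS (filterI (HX _ e20) (HY _ e20)) => s [h1 h2].
have -> : X s + Y s - (a + b) = (X s - a) + (Y s - b) by rewrite opprD addrACA.
by apply: le_lt_trans (msizeD _ _) _; lra.
Qed.

Lemma mcvgN X a : X @ Fl --> a -> (fun s => - X s) @ Fl --> - a.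
Proof.
move=> /cvg_msizeP HX; apply/cvg_msizeP => e e0.
by apply: filterS (HX _ e0) => s; rewrite -msizeN opprB opprK addrC.
Qed.

Lemma mcvgB X Y a b : X @ Fl --> a -> Y @ Fl --> b ->
  (fun s => X s - Y s) @ Fl --> a - b.
Proof. by move=> HX HY; apply: mcvgD => //; exact: mcvgN. Qed.

End CvgLinear.

Lemma mcvg_near {R : realType} {F : metricFrechet R} {S : Type}
    (Fl : set_system S) {FF : Filter Fl} (X Y : S -> F) (l : F) :
  (\forall s \near Fl, X s = Y s) -> X @ Fl --> l -> Y @ Fl --> l.
Proof.
move=> XY /cvg_msizeP H; apply/cvg_msizeP => e e0.
by apply: filterS (filterI XY (H e e0)) => s [->].
Qed.

Lemma mcvg_sum {R : realType} {F : metricFrechet R} {S I : Type}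
    (Fl : set_system S) {FF : Filter Fl} (r : seq I) (X : I -> S -> F) (l : I -> F) :
  (forall i, X i @ Fl --> l i) ->
  (fun s => \sum_(i <- r) X i s) @ Fl --> \sum_(i <- r) l i.
Proof.
move=> H; elim: r => [|i r IH].
  rewrite big_nil; apply: mcvg_near (cvg_cst (0 : F)).
  by apply: nearW => s; rewrite big_nil.
rewrite big_cons; apply: mcvg_near (mcvgD (H i) IH).
by apply: nearW => s; rewrite big_cons.
Qed.

(** * Directional derivatives and the mean value inequality *)

Lemma near_dnbhs0P {R : realType} (P : set R) :
  (\forall t \near 0^', P t) <->
  exists2 delta : R, 0 < delta & forall t, t != 0 -> `|t| < delta -> P t.
Proof.
split=> [|[delta delta0 H]].
  case=> delta delta0 H; exists delta => // t t0 td; apply: H => //=.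
  by rewrite sub0r normrN.
exists delta => // t /=; rewrite sub0r normrN => td t0; exact: H.
Qed.

Lemma near_dnbhs0_neq {R : realType} : \forall t \near (0 : R)^', t != 0.
Proof. by apply/near_dnbhs0P; exists 1. Qed.

Lemma cvg_of_quotient {R : realType} {F : metricFrechet R} (p : nat -> F -> R)
    (X : R -> F) (x v : F) : grading p ->
  (fun t => t^-1 *: (X t - x)) @ 0^' --> v -> X @ 0^' --> x.
Proof.
move=> gp H; apply/(grading_cvgP gp) => m e e0.
have sp := (grading_cseminorm m gp).1; have pv := snorm_ge0 sp v.
have D0 : 0 < p m v + 1 by lra.
move/(grading_cvgP gp)/(_ m 1 ltr01) : H => H.
have small : \forall t \near (0 : R)^', `|t| < e / (p m v + 1).
  by apply/near_dnbhs0P; exists (e / (p m v + 1)) => //; exact: divr_gt0.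
apply: filterS (filterI (filterI H small) near_dnbhs0_neq) => t [[h1 h2] t0].
have -> : X t - x = t *: (t^-1 *: (X t - x)) by rewrite scalerA mulfV// scale1r.
rewrite (snormZ sp); have := snormD sp (t^-1 *: (X t - x) - v) v.
rewrite subrK; move: h2; rewrite ltr_pdivlMr//.
have := normr_ge0 t; nra.
Qed.

Lemma line_cvg {R : realType} {F : metricFrechet R} (p : nat -> F -> R)
    (x v : F) : grading p -> (fun t : R => x + t *: v) @ 0^' --> x.
Proof.
move=> gp; apply: (cvg_of_quotient (v := v) gp); apply: mcvg_near (cvg_cst v).
apply: filterS near_dnbhs0_neq => t t0.
by rewrite addrAC subrr add0r scalerA mulVf// scale1r.
Qed.

Section Derivatives.
Context {R : realType} {F G : metricFrechet R}.
Implicit Types (Q : F -> G) (x v : F) (l : G).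

Definition has_derivative Q x v l := diff_quotient Q x v @ 0^' --> l.

Lemma DderiveE Q x v l : has_derivative Q x v l -> Dderive Q x v = l.
Proof.
move=> H; have HD : has_derivative Q x v (Dderive Q x v).
  by rewrite /Dderive; case: xgetP => [y _ //|/(_ l)].
exact: cvg_msize_unique HD H.
Qed.

Lemma Dderivable_has Q x v : Dderivable Q x v -> has_derivative Q x v (Dderive Q x v).
Proof. by move=> [l Hl]; rewrite (DderiveE Hl). Qed.

Lemma diff_quotient_shift Q x v t h :
  h^-1 *: (Q (x + (t + h) *: v) - Q (x + t *: v)) =
  diff_quotient Q (x + t *: v) v h.
Proof. by rewrite /diff_quotient scalerDl addrA. Qed.

End Derivatives.

Section MeanValue.
Context {R : realType} {F : metricFrechet R}.
Variable p : F -> R.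
Hypothesis cp : cseminorm p.

Let sp : seminorm p. Proof. by case: cp. Qed.

Lemma cseminorm_cvg {S : Type} (Fl : set_system S) {FF : Filter Fl}
    (X : S -> F) (l : F) : X @ Fl --> l ->
  forall e, 0 < e -> \forall s \near Fl, p (X s - l) < e.
Proof.
move=> /cvg_msizeP H e e0; have [eta eta0 K] := cp.2 e e0.
by apply: filterS (H _ eta0) => s /K.
Qed.

(** The classical supremum argument: the set of times up to which the bound
with slope [M + e] holds is closed at its supremum and extends past any point
below 1, both because the difference quotient there is within [e] of a vector
of size at most [M]. *)
Lemma mean_value (g g' : R -> F) (M : R) :
  (forall t, 0 <= t <= 1 ->
     (fun h => h^-1 *: (g (t + h) - g t)) @ 0^' --> g' t) ->
  (forall t, 0 <= t <= 1 -> p (g' t) <= M) ->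
  p (g 1 - g 0) <= M.
Proof.
move=> dg bg; apply/ler_addgt0Pr => e e0.
have M0 : 0 <= M by rewrite (le_trans (snorm_ge0 sp (g' 0)))// bg// lexx ler01.
have loc t : 0 <= t <= 1 -> exists2 delta, 0 < delta &
    forall h, `|h| < delta -> p (g (t + h) - g t) <= (M + e) * `|h|.
  move=> t01; have [delta delta0 H] := (near_dnbhs0P _).1 (cseminorm_cvg (dg t t01) e0).
  exists delta => // h hd; have [->|h0] := eqVneq h 0.
    by rewrite addr0 subrr (snorm0 sp) normr0 mulr0.
  have {}H := H h h0 hd.
  have : p (h^-1 *: (g (t + h) - g t)) <= M + e.
    rewrite -[X in p X](subrK (g' t)); apply: le_trans (snormD sp _ _) _.
    by have := bg t t01; lra.
  rewrite (snormZ sp) normfV mulrC ler_pdivrMr ?normr_gt0//.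
pose S : set R := [set t | 0 <= t <= 1 /\ p (g t - g 0) <= (M + e) * t].
have S0 : S 0 by split; [rewrite lexx ler01|rewrite subrr (snorm0 sp) mulr0].
have hS : has_sup S by split; [exists 0|exists 1 => t [/andP[]]].
have s01 : 0 <= sup S <= 1.
  apply/andP; split; first exact: ub_le_sup hS.2 _ S0.
  by apply: ge_sup; [exists 0|move=> t [/andP[]]].
have [delta delta0 D] := loc _ s01.
have Ss : S (sup S).
  split=> //; have [t [t01 St] ts] := sup_adherent delta0 hS.
  have tles : t <= sup S by apply: ub_le_sup => //; exact: hS.2.
  have ht : `|t - sup S| < delta by rewrite ler0_norm; lra.
  have := D _ ht; rewrite subrKC (snormBC sp) distrC ger0_norm ?subr_ge0// => Dt.
  apply: le_trans (snorm_trans sp _ (g t) _) _; nra.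
suff -> : 1 = sup S by case: Ss => _ /le_trans; apply; case/andP: s01 => s0 s1; nra.
apply/eqP; rewrite eq_le; case/andP: (s01) => s0 s1; rewrite s1 andbT leNgt.
apply/negP => sl1.
pose h := Num.min (delta / 2) (1 - sup S).
have h0 : 0 < h by rewrite lt_min divr_gt0//= subr_gt0.
have hd : h <= delta / 2 by rewrite ge_min lexx.
have h1 : h <= 1 - sup S by rewrite ge_min lexx orbT.
suff /(ub_le_sup hS.2) : S (sup S + h) by lra.
split; first by apply/andP; split; lra.
have := D h; rewrite (ger0_norm (ltW h0)) => Dh.
apply: le_trans (snorm_trans sp _ (g (sup S)) _) _.
rewrite mulrDr addrC lerD//; first by case: Ss.
by apply: Dh; lra.
Qed.

Lemma mean_value_line {E : metricFrechet R} (Q : E -> F) (D : R -> F) x v l M :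
  (forall t, 0 <= t <= 1 -> has_derivative Q (x + t *: v) v (D t)) ->
  (forall t, 0 <= t <= 1 -> p (D t - l) <= M) ->
  p (Q (x + v) - Q x - l) <= M.
Proof.
move=> dQ bQ.
have := @mean_value (fun t => Q (x + t *: v) - t *: l) (fun t => D t - l) M.
rewrite scale1r scale0r addr0 scale0r subr0 addrAC scale1r; apply => // t t01.
apply/cvg_msizeP => e e0; have [delta delta0 H] := (near_dnbhs0P _).1 ((cvg_msizeP _ _).1 (dQ t t01) e e0).
apply/near_dnbhs0P; exists delta => // h h0 hd.
have := H h h0 hd; congr (msize _ < _).
rewrite -diff_quotient_shift; set a := Q _; set b := Q _.
have -> : a - (t + h) *: l - (b - t *: l) = (a - b) - h *: l.
  rewrite scalerDl !opprD opprK !addrA [LHS](ACl (1 * 4 * 3 * (2 * 5)))/=.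
  by rewrite addNr addr0.
by rewrite [in RHS]scalerBr scalerA mulVf// scale1r opprB subrKA.
Qed.

End MeanValue.

(** * Maps near the identity *)

Section LinearPredicate.
Context {R : realType} {V W : lmodType R} (f : V -> W).
Hypothesis lf : linear f.

Lemma lin0 : f 0 = 0.
Proof.
have := lf (-1) 0 0.
by rewrite scaleN1r oppr0 addr0 scaleN1r addrC subrr.
Qed.

Lemma linZ a v : f (a *: v) = a *: f v.
Proof. by have := lf a v 0; rewrite lin0 !addr0. Qed.

Lemma linD v w : f (v + w) = f v + f w.
Proof. by have := lf 1 v w; rewrite !scale1r. Qed.

Lemma linN v : f (- v) = - f v.
Proof. by rewrite -scaleN1r linZ scaleN1r. Qed.

Lemma linB v w : f (v - w) = f v - f w.
Proof. by rewrite linD linN. Qed.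

End LinearPredicate.

Lemma segment_subr {R : pzRingType} {V : lmodType R} (x y z : V) (t : R) :
  x + t *: (y - x) - z = t *: (y - z) + (1 - t) *: (x - z).
Proof.
have -> : y - x = (y - z) - (x - z) by rewrite opprB subrKA.
rewrite scalerBr [RHS]addrC scalerBl scale1r addrA.
by rewrite [LHS](ACl (1 * 4 * 3 * 2)).
Qed.

(** Homogeneous bounds only need to be checked on the unit ball. *)
Lemma le_of_unit_ball {R : realType} (a b : R) : 0 <= a ->
  (forall t, 0 < t -> t * a <= 1 -> t * b <= 1) -> b <= a.
Proof.
move=> a0 H; rewrite leNgt; apply/negP => ab.
have ab0 : 0 < a + b by lra.
have := H (2 / (a + b)) (divr_gt0 (ltr0Sn _ 1) ab0).
rewrite mulrAC ler_pdivrMr// mulrAC ler_pdivrMr//; lra.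
Qed.

(** The situation in which the inverse function theorem is proved. [phi1] and
[phi2] stand for the first two derivatives of [phi]; the second derivative is
taken in its last argument. *)
Record near_identity {R : realType} {F : metricFrechet R} (bar : F -> R)
    (phi : F -> F) (phi1 : F -> F -> F) (phi2 : F -> F -> F -> F)
    (U : set F) (x0 : F) (r C : R) : Prop := NearIdentity {
  ni_bar : cseminorm bar;
  ni_bar_ball : forall v, bar v <= 1 -> msize v < r;
  ni_r : 0 < r;
  ni_C : 0 < C;
  ni_convex : forall x y (t : R), U x -> U y -> 0 <= t <= 1 -> U (x + t *: (y - x));
  ni_center : U x0;
  ni_phi : forall x v, U x -> has_derivative phi x v (phi1 x v);
  ni_phi1 : forall x q v, U x -> has_derivative (phi1^~ q) x v (phi2 x q v);
  ni_cont : forall x, U x -> phi @ x --> phi x;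
  ni_lin1 : forall x, U x -> linear (phi1 x);
  ni_lin2l : forall x v, U x -> linear (fun q => phi2 x q v);
  ni_lin2r : forall x q, U x -> linear (phi2 x q);
  ni_phi1_center : forall q, phi1 x0 q = q;
  ni_near : forall x q, U x -> msize q < r -> msize (phi1 x q - q) <= msize q / 2;
  ni_near_bar : forall x q, U x -> bar (phi1 x q - q) <= bar q / 2;
  ni_phi2 : forall x q v, U x -> msize q < r -> msize v < r ->
    msize (phi2 x q v) <= C * msize q * msize v }.

Section NearIdentity.
Context {R : realType} {F : metricFrechet R}.
Variables (p : nat -> F -> R) (bar : F -> R).
Variables (phi : F -> F) (phi1 : F -> F -> F) (phi2 : F -> F -> F -> F).
Variables (U : set F) (x0 : F) (r C : R).
Hypothesis gp : grading p.
Hypothesis msizeZ_le : forall (l : R) (v : F), 0 <= l <= 1 -> msize (l *: v) <= msize v.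
Hypothesis NI : near_identity bar phi phi1 phi2 U x0 r C.

Let cbar := ni_bar NI.
Let bar_ball := ni_bar_ball NI.
Let r0 := ni_r NI.
Let C0 := ni_C NI.
Let convU := ni_convex NI.
Let Ux0 := ni_center NI.
Let dphi := ni_phi NI.
Let dphi1 := ni_phi1 NI.
Let phi_cont := ni_cont NI.
Let lin_phi1 := ni_lin1 NI.
Let lin_phi2l := ni_lin2l NI.
Let lin_phi2r := ni_lin2r NI.
Let phi1_x0 := ni_phi1_center NI.
Let phi1_near := ni_near NI.
Let phi1_bar := ni_near_bar NI.
Let phi2_bound := ni_phi2 NI.

Let sbar : seminorm bar. Proof. by case: cbar. Qed.

Implicit Types (q : F -> R) (k l e t : R) (v w x y z u : F).

(** A bound on the second derivative in the direction [v] that controls an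
arbitrary seminorm [q] by the fixed seminorm [bar]. *)
Definition gain (q : F -> R) (k : R) (v : F) :=
  forall u x, U u -> q (phi2 u x v) <= k * bar x.

Lemma gainW q k k' v : k <= k' -> gain q k v -> gain q k' v.
Proof.
move=> kk H u x Uu; apply: le_trans (H u x Uu) _.
by rewrite ler_wpM2r// (snorm_ge0 sbar).
Qed.

Lemma gainD q k k' v w : seminorm q ->
  gain q k v -> gain q k' w -> gain q (k + k') (v + w).
Proof.
move=> sq H H' u x Uu; rewrite (linD (lin_phi2r x Uu)) mulrDl.
by apply: le_trans (snormD sq _ _) _; apply: lerD; [exact: H|exact: H'].
Qed.

Lemma gainZ q k l v : seminorm q -> 0 <= l ->
  gain q k v -> gain q (l * k) (l *: v).
Proof.
move=> sq l0 H u x Uu; rewrite (linZ (lin_phi2r x Uu)) (snormZ_ge0 sq)// -mulrA.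
by rewrite ler_wpM2l// H.
Qed.

(** By homogeneity it suffices to take [x] in the unit ball of [bar], where
[x] has size less than [r], and to replace [v] by [l *: v], which makes the
product [C * r * msize (l *: v)] as small as [q] requires. *)
Lemma gain_small q : cseminorm q -> exists2 eta : R, 0 < eta &
  forall l v, 0 < l -> msize (l *: v) < eta -> gain q l^-1 v.
Proof.
move=> [sq cq]; have [eta eta0 Heta] := cq 1 ltr01.
have Cr0 : 0 < C * r by rewrite mulr_gt0.
exists (Num.min r (eta / (C * r))); first by rewrite lt_min r0 divr_gt0.
move=> l v l0; rewrite lt_min ltr_pdivlMr// => /andP[vr veta] u x Uu.
rewrite mulrC ler_pdivlMr// mulrC; apply: le_of_unit_ball => [|t t0 tx].
  exact: snorm_ge0.
rewrite mulrA -(snormZ_ge0 sq) ?(ltW (mulr_gt0 t0 l0))// -scalerA.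
rewrite -(linZ (lin_phi2r x Uu)) -(linZ (lin_phi2l _ Uu)).
apply/ltW/Heta; apply: le_lt_trans veta.
have txr : msize (t *: x) < r by apply: bar_ball; rewrite (snormZ_ge0 sbar _ (ltW t0)).
apply: le_trans (phi2_bound Uu txr vr) _; rewrite [leRHS]mulrC.
by rewrite ler_wpM2r ?msize_ge0// ler_wpM2l// ltW.
Qed.

(** The constant depends on [y] only. In this way one vector [y] controls all
solutions of [phi1 x v = y] at the same time. *)
Lemma gain_dominated q y : cseminorm q -> exists2 k : R, 0 < k &
  forall v, (forall l, 0 <= l <= 1 -> msize (l *: v) <= 2 * msize (l *: y)) ->
  gain q k v.
Proof.
move=> cq; have [eta eta0 H] := gain_small cq.
have [l [l0 l1 ly]] := msize_scale_small gp y (divr_gt0 eta0 (ltr0Sn _ 1) : 0 < eta / 2).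
exists l^-1; first by rewrite invr_gt0.
move=> v /(_ l); rewrite l1 ltW// => /(_ isT) Hv; apply: H => //; lra.
Qed.

Lemma gain_any q v : cseminorm q -> exists2 k : R, 0 < k & gain q k v.
Proof.
move=> /(@gain_dominated _ v)[k k0 H]; exists k => //; apply: H => l l01.
by have := msize_ge0 (l *: v); lra.
Qed.

Lemma gain_near0 q e : cseminorm q -> 0 < e -> exists2 delta : R, 0 < delta &
  forall v, msize v < delta -> gain q e v.
Proof.
move=> cq e0; have [eta eta0 H] := gain_small cq.
have [delta delta0 D] := msize_scale_cvg0 gp e^-1 eta0.
exists delta => // v /D Hv; rewrite -(invrK e); apply: H => //.
by rewrite invr_gt0.
Qed.

Lemma gain_segment q k x y t : seminorm q -> 0 <= t <= 1 ->
  gain q k (x - x0) -> gain q k (y - x0) -> gain q k (y + t *: (x - y) - x0).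
Proof.
move=> sq /andP[t0 t1] Hx Hy.
rewrite segment_subr.
have -> : k = t * k + (1 - t) * k by ring.
by apply: gainD => //; apply: gainZ => //; lra.
Qed.

(** Integrate the second derivative from [x0], where [phi1] is the identity. *)
Lemma phi1_gain q k z : cseminorm q -> U z -> gain q k (z - x0) ->
  forall x, q (phi1 z x - x) <= k * bar x.
Proof.
move=> cq Uz Hz x.
have := @mean_value_line _ _ _ cq _ (phi1^~ x)
  (fun t => phi2 (x0 + t *: (z - x0)) x (z - x0)) x0 (z - x0) 0 (k * bar x).
rewrite subrKC phi1_x0 subr0; apply => t t01.
  by apply: dphi1; exact: convU.
by rewrite subr0; apply: Hz; exact: convU.
Qed.

Lemma phi1_close q k z e v : cseminorm q -> U z -> U (z + v) -> gain q k v ->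
  0 <= e <= 1 -> 0 <= k ->
  forall x, q (phi1 (z + e *: v) x - phi1 z x) <= k * bar x.
Proof.
move=> cq Uz Uv Hv /andP[e0 e1] k0 x.
have sq := cq.1.
have mem t : 0 <= t <= 1 -> U (z + t *: (e *: v)).
  move=> /andP[t0 t1]; rewrite scalerA -[v in _ *: v](addKr z) [_ + (z + v)]addrC.
  by apply: convU => //; apply/andP; split; nra.
have := @mean_value_line _ _ _ cq _ (phi1^~ x)
  (fun t => phi2 (z + t *: (e *: v)) x (e *: v)) z (e *: v) 0 (k * bar x).
rewrite subr0; apply => t t01; first by apply: dphi1; exact: mem.
rewrite subr0; apply: (@gainW _ (e * k)) (mem t t01) => //; first nra.
exact: gainZ.
Qed.

Lemma comparison q k x y : cseminorm q -> U x -> U y ->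
  gain q k (x - x0) -> gain q k (y - x0) ->
  q (phi x - phi y - (x - y)) <= k * bar (x - y).
Proof.
move=> cq Ux Uy Hx Hy.
have := @mean_value_line _ _ _ cq _ phi
  (fun t => phi1 (y + t *: (x - y)) (x - y)) y (x - y) (x - y) (k * bar (x - y)).
rewrite subrKC; apply => t t01; first by apply: dphi; exact: convU.
by apply: phi1_gain => //; [exact: convU|apply: gain_segment => //; exact: cq.1].
Qed.

Lemma bar_comparison x y : U x -> U y -> bar (x - y) <= 2 * bar (phi x - phi y).
Proof.
move=> Ux Uy.
have := @mean_value_line _ _ _ cbar _ phi
  (fun t => phi1 (y + t *: (x - y)) (x - y)) y (x - y) (x - y) (bar (x - y) / 2).
rewrite subrKC => H.
have {}H : bar (phi x - phi y - (x - y)) <= bar (x - y) / 2.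
  by apply: H => t t01; [apply: dphi; exact: convU|apply: phi1_bar; exact: convU].
have := snormB sbar (phi x - phi y) (phi x - phi y - (x - y)).
rewrite opprB addrC subrK; lra.
Qed.

(** The bound by [bar (x - y)] in [comparison] is turned into one by
[bar (phi x - phi y)] with [bar_comparison]: [phi - id] contracts [bar] by
[1 / 2]. *)
Lemma seminorm_comparison q k x y : cseminorm q -> 0 <= k -> U x -> U y ->
  gain q k (x - x0) -> gain q k (y - x0) ->
  q (x - y) <= q (phi x - phi y) + 2 * k * bar (phi x - phi y).
Proof.
move=> cq k0 Ux Uy Hx Hy; have := comparison cq Ux Uy Hx Hy.
have := bar_comparison Ux Uy.
have := snormB cq.1 (phi x - phi y) (phi x - phi y - (x - y)).
rewrite opprB addrC subrK; nra.
Qed.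

Lemma phi_inj x y : U x -> U y -> phi x = phi y -> x = y.
Proof.
move=> Ux Uy xy; apply/eqP; rewrite -subr_eq0; apply/eqP.
apply: (grading_eq0 gp) => m; have cq := grading_cseminorm m gp.
have [k k0 Hk] := gain_any (x - x0) cq.
have [k' k'0 Hk'] := gain_any (y - x0) cq.
have := @seminorm_comparison _ (k + k') x y cq.
rewrite xy subrr (snorm0 cq.1) (snorm0 sbar) mulr0 addr0.
move=> H; apply/eqP; rewrite eq_le (snorm_ge0 cq.1) andbT; apply: H => //.
- by rewrite addr_ge0 ?ltW.
- by apply: gainW Hk; lra.
- by apply: gainW Hk'; lra.
Qed.

Lemma bar_phi1 z x : U z -> bar x <= 2 * bar (phi1 z x).
Proof.
move=> Uz; have := phi1_bar x Uz; have := snormB sbar (phi1 z x) (phi1 z x - x).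
rewrite opprB addrC subrK; lra.
Qed.

Lemma phi1_seminorm_bound q k z x : cseminorm q -> 0 <= k -> U z -> gain q k (z - x0) ->
  q x <= q (phi1 z x) + 2 * k * bar (phi1 z x).
Proof.
move=> cq k0 Uz Hz; have := phi1_gain cq Uz Hz x; have := bar_phi1 x Uz.
have := snormB cq.1 (phi1 z x) (phi1 z x - x).
rewrite opprB addrC subrK; nra.
Qed.

Lemma phi1_eq0 z x : U z -> phi1 z x = 0 -> x = 0.
Proof.
move=> Uz zx; apply: (grading_eq0 gp) => m; have cq := grading_cseminorm m gp.
have [k k0 Hk] := gain_any (z - x0) cq.
have := phi1_seminorm_bound x cq (ltW k0) Uz Hk.
rewrite zx (snorm0 cq.1) (snorm0 sbar) mulr0 addr0 => H.
by apply/eqP; rewrite eq_le H (snorm_ge0 cq.1).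
Qed.

(** The Neumann series. Its terms are halved at each step in the metric, without
any homogeneity; and since [l *: v] is the sum of the series for [l *: y], the
bound on the sum holds for every multiple, which is what [gain_dominated]
asks for. *)
Lemma phi1_solve_small x y : U x -> msize y < r / 2 ->
  exists2 v, phi1 x v = y &
    forall l, 0 <= l <= 1 -> msize (l *: v) <= 2 * msize (l *: y).
Proof.
move=> Ux yr; pose psi w := phi1 x w - w.
have lpsi : linear psi by move=> a v w; rewrite /psi lin_phi1// opprD scalerBr addrACA.
pose s := fix s n := if n is n'.+1 then y - psi (s n') else 0.
have psi_le w : msize w < r -> msize (psi w) <= msize w / 2 by exact: phi1_near.
have dom n l : 0 <= l <= 1 -> msize (l *: s n) <= 2 * msize (l *: y).
  move=> l01; have ly := msizeZ_le y l01; elim: n => [|n IH] /=.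
    by rewrite scaler0 msize0; have := msize_ge0 (l *: y); lra.
  rewrite scalerBr -(linZ lpsi); apply: le_trans (msizeD _ _) _; rewrite msizeN.
  have := psi_le (l *: s n); lra.
have lt_r n : msize (s n) < r.
  have := @dom n 1; rewrite ler01 lexx !scale1r => /(_ isT); lra.
have step n : msize (s n.+1 - s n) <= 2^-n * msize y.
  elim: n => [|n IH]; first by rewrite /= (lin0 lpsi) !subr0 expr0 invr1 mul1r.
  have -> : s n.+2 - s n.+1 = psi (s n - s n.+1).
    rewrite (linB lpsi).
    have BK (a b c : F) : a - b - (a - c) = c - b by rewrite opprB addrC addrA subrK.
    exact: (BK y (psi (s n.+1)) (psi (s n))).
  have yy := msize_ge0 y.
  have n1 : 2^-n <= 1 :> R by rewrite invf_le1 ?exprn_gt0// exprn_ege1// ler1n.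
  have := psi_le (s n - s n.+1); rewrite msizeBC => H.
  have : 2^-n * msize y <= msize y by nra.
  rewrite exprS invfM => ?; have := H ltac:(lra); lra.
have tail n m : msize (s (n + m)%N - s n) <= 2 * (2^-n * msize y).
  suff : msize (s (n + m)%N - s n) <= 2 * (2^-n * msize y) - 2 * (2^-(n + m) * msize y).
    have : 0 <= 2^-(n + m) * msize y by rewrite mulr_ge0 ?msize_ge0// invr_ge0 exprn_ge0.
    lra.
  elim: m => [|m IH]; first by rewrite addn0 !subrr msize0.
  rewrite addnS -[s _ - _](subrKA (s (n + m)%N)).
  apply: le_trans (msizeD _ _) _; have := step (n + m)%N.
  rewrite exprS invfM; lra.
have small e : 0 < e -> exists N : nat, 2 * (2^-N * msize y) < e.
  move=> e0; pose K := 2 * msize y / e.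
  have K0 : 0 <= K by rewrite divr_ge0 ?mulr_ge0 ?msize_ge0 ?(ltW e0).
  exists (Num.truncn K).+1.
  have : K < 2 ^+ (Num.truncn K).+1.
    apply: lt_trans (truncnS_gt K) _; rewrite -natrX ltr_nat; exact: ltn_expl.
  rewrite /K ltr_pdivrMr// => H.
  by rewrite mulrCA [ltLHS]mulrC ltr_pdivrMr ?exprn_gt0// [ltRHS]mulrC.
have [|v sv] := @mf_complete _ F s.
  move=> e e0; have [N HN] := small (e / 2) (divr_gt0 e0 (ltr0Sn _ 1)).
  exists N => i j /subnKC <- /subnKC <-; rewrite mf_dist_msize.
  rewrite -[_ - _](subrKA (s N)); apply: le_lt_trans (msizeD _ _) _.
  rewrite [X in _ + X]msizeBC; have := tail N (i - N)%N; have := tail N (j - N)%N; lra.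
move/cvg_msizeP in sv.
have near_v e : 0 < e -> exists n, msize (s n - v) < e /\ msize (s n.+1 - v) < e.
  move=> /sv [N _ HN]; exists N; split; apply: HN => //=.
exists v; last first.
  move=> l l01; apply/ler_addgt0Pr => e e0; have [n [sn _]] := near_v e e0.
  have := dom n l l01; have := msizeZ_le (v - s n) l01.
  have := msizeD (l *: (v - s n)) (l *: s n).
  rewrite -scalerDr subrK (msizeBC v); lra.
apply/eqP; rewrite -subr_eq0; apply/eqP/msize_eq0/eqP.
rewrite eq_le msize_ge0 andbT; apply/ler_addgt0Pr => e e0; rewrite add0r.
have er0 : 0 < Num.min r (e / 2) by rewrite lt_min r0 divr_gt0.
have [n []] := near_v _ er0; rewrite !lt_min => /andP[vr v1] /andP[_ v2].
have -> : phi1 x v - y = (v - s n.+1) + psi (v - s n).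
  rewrite (linB lpsi) -[s n.+1]/(y - psi (s n)) opprB addrACA.
  by rewrite [psi _ - y - _]addrAC subrr add0r /psi subrKC.
apply: le_trans (msizeD _ _) _.
have := psi_le (v - s n); rewrite (msizeBC v (s n)) (msizeBC v); have := msize_ge0 (s n - v); lra.
Qed.

Lemma phi1_surj x y : U x -> exists v, phi1 x v = y.
Proof.
move=> Ux; have [l [l0 _ ly]] := msize_scale_small gp y (divr_gt0 r0 (ltr0Sn _ 1) : 0 < r / 2).
have [v vy _] := phi1_solve_small Ux ly.
by exists (l^-1 *: v); rewrite (linZ (lin_phi1 Ux)) vy scalerA mulVf ?scale1r ?gt_eqF.
Qed.

(** The second-order remainder: the mean value inequality for [phi] and
then, in [phi1_close], for [phi1]. *)
Lemma taylor_step q k z w : cseminorm q -> U z -> U (z + w) -> 0 <= k ->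
  gain q k w -> q (phi (z + w) - phi z - phi1 z w) <= k * bar w.
Proof.
move=> cq Uz Uw k0 Hw.
apply: (@mean_value_line _ _ _ cq _ phi (fun t => phi1 (z + t *: w) w)) => t t01.
  apply: dphi; rewrite -[w in t *: w](addKr z) [- z + _]addrC.
  exact: convU.
exact: phi1_close.
Qed.

(** The Euler polygon with [n + 1] steps of length [1 / (n + 1)] for the equation
[x' = phi1(x)^-1 y], started at [z0]. *)
Lemma local_surjectivity z0 m sigma : 0 < sigma ->
  (forall x, p m (x - z0) < sigma -> U x) ->
  exists2 eta : R, 0 < eta & forall y, msize y < eta ->
    exists2 x, p m (x - z0) < sigma & phi x = phi z0 + y.
Proof.
move=> sigma0 ballU; have cm := grading_cseminorm m gp; have sm := cm.1.
have Uz0 : U z0 by apply: ballU; rewrite subrr (snorm0 sm).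
(* For [y] this small the field [phi1(x)^-1 y] is at most [sigma / 2] in [p m], so
   the polygons do not leave the ball within time 1, and at most 1 in [bar]. *)
have [d1 d10 D1] := cm.2 (sigma / 2) (divr_gt0 sigma0 (ltr0Sn _ 1)).
have [d2 d20 D2] := cbar.2 1 ltr01.
exists (Num.min (r / 2) (Num.min (d1 / 2) (d2 / 2))).
  by rewrite !lt_min !divr_gt0.
move=> y; rewrite !lt_min => /and3P[yr y1 y2].
have /choice[B HB] : forall x, exists v, U x -> phi1 x v = y /\
    forall l, 0 <= l <= 1 -> msize (l *: v) <= 2 * msize (l *: y).
  move=> x; have [Ux|nUx] := pselect (U x); last by exists 0.
  by have [v v1 v2] := phi1_solve_small Ux yr; exists v.
have Bsize x : U x -> msize (B x) <= 2 * msize y.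
  by move=> /HB[_ /(_ 1)]; rewrite ler01 lexx !scale1r; apply.
have Bm x : U x -> p m (B x) <= sigma / 2.
  by move=> /Bsize Bx; apply/ltW/D1; lra.
have Bbar x : U x -> bar (B x) <= 1.
  by move=> /Bsize Bx; apply/ltW/D2; lra.
pose h n : R := n.+1%:R^-1.
have h0 n : 0 < h n by rewrite invr_gt0 ltr0Sn.
pose c n := fix c i := if i is i'.+1 then c i' + h n *: B (c i') else z0.
have ih1 n i : (i <= n.+1)%N -> i%:R * h n <= 1.
  by move=> ile; rewrite ler_pdivrMr ?ltr0Sn// mul1r ler_nat.
have cm_le n i : (i <= n.+1)%N -> p m (c n i - z0) <= i%:R * h n * (sigma / 2).
  elim: i => [_|i IH ile]; first by rewrite subrr (snorm0 sm) !mul0r.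
  have {}IH := IH (ltnW ile); have i1 := ih1 n i (ltnW ile).
  have Uc : U (c n i) by apply: ballU; nra.
  rewrite /= addrAC; apply: le_trans (snormD sm _ _) _.
  rewrite (snormZ_ge0 sm _ (ltW (h0 n))) -natr1.
  by have := Bm _ Uc; have := h0 n; nra.
have cU n i : (i <= n.+1)%N -> U (c n i).
  move=> ile; apply: ballU; have := cm_le n i ile; have := ih1 n i ile; nra.
pose x n := c n n.+1.
have nh n : n.+1%:R * h n = 1 by rewrite mulfV// pnatr_eq0.
have Ux n : U (x n) by exact: cU.
(* Each step is [h n] times a solution that gains with constant [k]; by
   [taylor_step] it misses [h n *: y] by at most [k * h n ^ 2]. *)
have approx q : cseminorm q -> exists2 k : R, 0 < k & forall n,
    gain q k (x n - z0) /\ q (phi (x n) - phi z0 - y) <= k * h n.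
  move=> cq; have sq := cq.1; have [k k0 Hk] := gain_dominated y cq.
  have kB z : U z -> gain q k (B z) by move=> /HB[_]; exact: Hk.
  exists k => // n.
  suff H i : (i <= n.+1)%N -> gain q (i%:R * h n * k) (c n i - z0) /\
      q (phi (c n i) - phi z0 - (i%:R * h n) *: y) <= i%:R * h n * (k * h n).
    by have := H n.+1 (leqnn _); rewrite nh scale1r !mul1r.
  elim: i => [_|i IH ile].
    rewrite !mul0r !subrr scale0r subr0 (snorm0 sq); split=> // u v Uu.
    by rewrite (lin0 (lin_phi2r v Uu)) (snorm0 sq) mul0r.
  have [IH1 IH2] := IH (ltnW ile); have Uc := cU n i (ltnW ile).
  have gB : gain q (h n * k) (h n *: B (c n i)) by apply: gainZ (ltW _) (kB _ _).
  split.
    rewrite /= addrAC -natr1 !mulrDl mul1r; exact: gainD.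
  have hk0 : 0 <= h n * k by rewrite mulr_ge0 ?ltW.
  have := taylor_step cq Uc (cU n i.+1 ile) hk0 gB.
  rewrite (linZ (lin_phi1 Uc)) (HB _ Uc).1 (snormZ_ge0 sbar _ (ltW (h0 n))) -/(c n i.+1) => T.
  have -> : phi (c n i.+1) - phi z0 - (i.+1%:R * h n) *: y =
      (phi (c n i.+1) - phi (c n i) - h n *: y) +
      (phi (c n i) - phi z0 - (i%:R * h n) *: y).
    rewrite addrACA subrKA -opprD -scalerDl; congr (_ - _ *: _).
    by rewrite -natr1 mulrDl mul1r addrC.
  apply: le_trans (snormD sq _ _) _.
  rewrite -natr1 !mulrDl mul1r [leRHS]addrC; apply: lerD IH2.
  apply: le_trans T _; rewrite -mulrA !(ler_wpM2l (ltW _))//.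
  by rewrite ler_piMr ?(ltW (h0 n))// Bbar.
have small M e : 0 < M -> 0 < e -> exists N : nat, forall n, (N <= n)%N -> M * h n < e.
  move=> M0 e0; exists (Num.truncn (M / e)) => n Nn.
  rewrite ltr_pdivrMr ?ltr0Sn// mulrC -ltr_pdivrMr//.
  by apply: lt_le_trans (truncnS_gt _) _; rewrite ler_nat.
have cauchy (k : nat) (e : R) : 0 < e -> exists N : nat, forall i j : nat,
    (N <= i)%N -> (N <= j)%N -> p k (x i - x j) < e.
  move=> e0; have ck := grading_cseminorm k gp.
  have [K K0 HK] := gain_any (z0 - x0) ck.
  have [a a0 Ha] := approx _ ck; have [b b0 Hb] := approx _ cbar.
  have gx n : gain (p k) (a + K) (x n - x0).
    by rewrite -[x n - x0](subrKA z0); apply: gainD => //; [exact: ck.1|exact: (Ha n).1].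
  have M0 : 0 < 2 * (a + 2 * (a + K) * b).
    by rewrite mulr_gt0// addr_gt0// !mulr_gt0// addr_gt0.
  have [N HN] := small _ _ M0 e0; exists N => i j /HN hi /HN hj.
  have aK0 : 0 <= a + K by lra.
  apply: le_lt_trans (seminorm_comparison ck aK0 (Ux i) (Ux j) (gx i) (gx j)) _.
  have diff q l : seminorm q -> (forall n, q (phi (x n) - phi z0 - y) <= l * h n) ->
      q (phi (x i) - phi (x j)) <= l * (h i + h j).
    move=> sq Hl; have := snormB sq (phi (x i) - phi z0 - y) (phi (x j) - phi z0 - y).
    by rewrite opprB addrA subrK opprB subrKA mulrDr; have := Hl i; have := Hl j; lra.
  have := diff _ _ ck.1 (fun n => (Ha n).2).
  have /(ler_wpM2l aK0) := diff _ _ sbar (fun n => (Hb n).2); lra.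
have [z xz] := grading_complete gp cauchy.
have zU : p m (z - z0) <= sigma / 2.
  apply/ler_addgt0Pr => e e0.
  have [N _ HN] := cseminorm_cvg cm xz e0.
  have := HN N (leqnn N); rewrite /= (snormBC sm).
  have := snorm_trans sm z (x N) z0; have := cm_le N N.+1 (leqnn _); rewrite nh; lra.
exists z; first lra.
have Uz : U z by apply: ballU; lra.
have cphi : phi (x n) @[n --> \oo] --> phi z.
  exact: cvg_comp xz (phi_cont Uz).
apply: cvg_msize_unique cphi _; apply/(grading_cvgP gp) => k' e e0.
have [a a0 Ha] := approx _ (grading_cseminorm k' gp).
have [N HN] := small _ _ a0 e0; exists N => // n /HN Hn.
by apply: le_lt_trans Hn; rewrite opprD addrA; exact: (Ha n).2.
Qed.

(** The increment [X t - x] is [O(t)] in [bar] by [bar_comparison], and it gains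
with a constant tending to 0, so the second-order remainder is [o(t)] in every
seminorm. *)
Lemma inverse_derivative (X : R -> F) x v w : U x -> phi1 x v = w ->
  X @ 0^' --> x ->
  (\forall t \near 0^', U (X t) /\ phi (X t) = phi x + t *: w) ->
  (fun t => t^-1 *: (X t - x)) @ 0^' --> v.
Proof.
move=> Ux vw Xx HX; pose err t := t^-1 *: (X t - x) - v.
have claim q e : cseminorm q -> 0 < e -> \forall t \near 0^', q (phi1 x (err t)) < e.
  move=> cq e0; have sq := cq.1.
  have D0 : 0 < 2 * (bar w + 1) by rewrite mulr_gt0// ltr_wpDl// (snorm_ge0 sbar).
  have e'0 := divr_gt0 e0 D0.
  have [d d0 Hd] := gain_near0 cq e'0.
  have Xd : \forall t \near 0^', msize (X t - x) < d.
    by move/cvg_msizeP : Xx; apply.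
  apply: filterS (filterI (filterI HX Xd) near_dnbhs0_neq) => t [[[UX XE] /Hd gX] t0].
  have := @taylor_step q _ x (X t - x) cq Ux.
  have PE : phi (X t) - phi x = t *: w by rewrite XE addrAC subrr add0r.
  rewrite subrKC PE => /(_ _ UX (ltW e'0) gX) T.
  have := bar_comparison UX Ux; rewrite PE (snormZ sbar) => T'.
  have -> : phi1 x (err t) = - (t^-1 *: (t *: w - phi1 x (X t - x))).
    rewrite /err (linB (lin_phi1 Ux)) (linZ (lin_phi1 Ux)) vw.
    by rewrite scalerBr scalerA mulVf// scale1r opprB.
  rewrite (snormN sq) (snormZ sq) normfV mulrC ltr_pdivrMr ?normr_gt0//.
  apply: le_lt_trans T _.
  have t0' : 0 < `|t| by rewrite normr_gt0.
  have b0 := snorm_ge0 sbar w.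
  rewrite mulrAC ltr_pdivrMr//; nra.
apply/(grading_cvgP gp) => m e e0; have cm := grading_cseminorm m gp.
have [K K0 HK] := gain_any (x - x0) cm.
have e20 : 0 < e / 2 by rewrite divr_gt0.
have D0 : 0 < 4 * K by rewrite mulr_gt0.
apply: filterS (filterI (claim _ _ cm e20) (claim _ _ cbar (divr_gt0 e0 D0))) => t [h1].
rewrite ltr_pdivlMr// => h2.
apply: le_lt_trans (phi1_seminorm_bound _ cm (ltW K0) Ux HK) _.
rewrite -/(err t); nra.
Qed.

Lemma phi1_inverse_cvg {S : Type} (Fl : set_system S) {FF : Filter Fl}
    (X Q : S -> F) x : U x -> X @ Fl --> x -> (\forall s \near Fl, U (X s)) ->
  (fun s => phi1 (X s) (Q s)) @ Fl --> (0 : F) -> Q @ Fl --> (0 : F).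
Proof.
move=> Ux Xx UX PQ; apply/(grading_cvgP gp) => m e e0.
have cm := grading_cseminorm m gp.
have [K K0 HK] := gain_any (x - x0) cm.
have [d d0 Hd] := gain_near0 cm ltr01.
have Xd : \forall s \near Fl, msize (X s - x) < d by move/cvg_msizeP : Xx; apply.
have e20 : 0 < e / 2 by rewrite divr_gt0.
have k0 : 0 < 1 + K by lra.
have D0 : 0 < 4 * (1 + K) by rewrite mulr_gt0.
apply: filterS (filterI (filterI UX Xd) (filterI (cseminorm_cvg cm PQ e20)
  (cseminorm_cvg cbar PQ (divr_gt0 e0 D0)))) => s [[Us /Hd gX]].
rewrite /= !subr0 => -[h1]; rewrite ltr_pdivlMr// => h2.
have gXs : gain (p m) (1 + K) (X s - x0).
  by rewrite -[X s - x0](subrKA x); apply: gainD => //; exact: cm.1.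
apply: le_lt_trans (phi1_seminorm_bound (Q s) cm (ltW k0) Us gXs) _; nra.
Qed.

End NearIdentity.

(** * Sum form, and the metric of spaces of bounded maps *)

Section SumForm.
Context {R : realType} {F : metricFrechet R}.

Lemma Phi_homo (s t : R) : 0 <= s -> s <= t -> Phi s <= Phi t.
Proof.
move=> s0 st; rewrite /Phi ler_pdivrMr; last lra.
by rewrite mulrAC ler_pdivlMr; lra.
Qed.

Lemma sum_form_grading : sum_form F -> exists p, @grading R F p.
Proof.
move=> [p [alpha [sp [_ bas] _ _ _]]]; exists p.
have sn m := (sp m).1.
split=> //.
- move=> m e e0; have /cvgrPdist_lt/(_ e e0) := (sp m).2 0.
  rewrite (snorm0 (sn m)) => /nbhs_msizeP[eta eta0 H]; exists eta => // v.
  rewrite -[v in msize v]subr0 => /H; rewrite sub0r normrN; exact: le_lt_trans (ler_norm _).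
- move=> eta eta0; have : nbhs (0 : F) [set v | msize v < eta].
    by apply/nbhs_msizeP; exists eta => // v; rewrite subr0.
  move=> /(bas 0)[B [[m [x [e [e0 ->]]]] /= x0] sub].
  exists m, (e - p m (0 - x)); first by rewrite subr_gt0.
  move=> v pv; apply: (sub v) => /=.
  have := snorm_trans (sn m) v 0 x; rewrite subr0; lra.
Qed.

Lemma sum_form_msizeZ : sum_form F ->
  forall (l : R) (v : F), 0 <= l <= 1 -> msize (l *: v) <= msize v.
Proof.
move=> [p [alpha [sp _ a0 _ H]]] l v /andP[l0 l1].
apply: ler_cvg_to (H (l *: v) 0) (H v 0) _; apply: nearW => n.
apply: ler_sum => i _; rewrite (ler_wpM2l (ltW (a0 i)))//; apply: Phi_homo.
  by apply: snorm_ge0; exact: (sp i).1.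
rewrite !subr0 (snormZ_ge0 (sp i).1)//.
by rewrite ler_piMl// (snorm_ge0 (sp i).1).
Qed.

End SumForm.

Section BracketBounds.
Context {R : realType} {F : metricFrechet R}.
Implicit Types (r : \bar R) (H : metricSubspace (R := R)).

Lemma bracket_bound r H (A : F -> ms_ambient H) (q : F) :
  (bracket r A < +oo)%E -> q != 0 -> ((msize q)%:E < r)%E ->
  ms_dist (A q) 0 <= fine (bracket r A) * msize q.
Proof.
move=> Afin q0 qr.
have b0 : (0 <= bracket r A)%E by rewrite /bracket le_max lexx.
have bfin : bracket r A \is a fin_num by rewrite ge0_fin_numE.
have sq0 : 0 < msize q.
  by rewrite lt_neqAle msize_ge0 andbT eq_sym; apply: contra_neq q0; exact: msize_eq0.
rewrite -ler_pdivrMr// -lee_fin fineK//.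
rewrite /bracket le_max; apply/orP; right.
by apply: ereal_sup_ubound; exists q.
Qed.

Lemma bracket_le r H (A : F -> ms_ambient H) (b : R) : 0 <= b ->
  (forall q, q != 0 -> ((msize q)%:E < r)%E -> ms_dist (A q) 0 <= b * msize q) ->
  (bracket r A <= b%:E)%E.
Proof.
move=> b0 HA; rewrite /bracket ge_max lee_fin b0/=.
apply: ge_ereal_sup => _ [q [q0 qr] <-].
rewrite lee_fin ler_pdivrMr; first exact: HA.
by rewrite lt_neqAle msize_ge0 andbT eq_sym; apply: contra_neq q0; exact: msize_eq0.
Qed.

Definition subadditive_dist H := forall a b : ms_ambient H,
  ms_carrier a -> ms_carrier b ->
  ms_dist (a - b) 0 <= ms_dist a 0 + ms_dist b 0.

Lemma bracketB r H (A B : ms_ambient (Bspace (F := F) r H)) :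
  subadditive_dist H -> ms_carrier A -> ms_carrier B ->
  (bracket r (A - B)%R <= (fine (bracket r A) + fine (bracket r B))%:E)%E.
Proof.
move=> sub [_ cA bA] [_ cB bB].
have fine0 (X : F -> ms_ambient H) : 0 <= fine (bracket r X).
  by rewrite fine_ge0// /bracket le_max lexx.
apply: bracket_le => [|q q0 qr]; first by rewrite addr_ge0.
apply: le_trans (sub _ _ (cA q) (cB q)) _.
by rewrite mulrDl lerD//; exact: bracket_bound.
Qed.

Lemma bracketB_fin r H (A B : ms_ambient (Bspace (F := F) r H)) :
  subadditive_dist H -> ms_carrier A -> ms_carrier B ->
  (bracket r (A - B)%R < +oo)%E.
Proof. by move=> sub cA cB; apply: le_lt_trans (bracketB sub cA cB) _; rewrite ltry. Qed.

Lemma subadditive_full (G : metricFrechet R) : subadditive_dist (full_space G).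
Proof. by move=> a b _ _; have := msizeD a (- b); rewrite msizeN. Qed.

Lemma subadditive_Bspace r H : subadditive_dist H -> subadditive_dist (Bspace (F := F) r H).
Proof.
move=> sub A B cA cB; rewrite /= !subr0 -lee_fin fineK; first exact: bracketB.
rewrite ge0_fin_numE; first exact: bracketB_fin.
by rewrite /bracket le_max lexx.
Qed.

(** [ms_dist] is a [fine] of a supremum, which would be 0 if the supremum were
infinite: that both maps lie in the carrier is essential. *)
Lemma ms_dist_bound r H (A B : ms_ambient (Bspace (F := F) r H)) (q : F) :
  subadditive_dist H -> ms_carrier A -> ms_carrier B ->
  q != 0 -> ((msize q)%:E < r)%E ->
  ms_dist (A q - B q) 0 <= ms_dist A B * msize q.
Proof.
by move=> sub cA cB q0 qr; apply: (bracket_bound (A := A - B)) => //; exact: bracketB_fin.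
Qed.

End BracketBounds.

(** * Multilinearity and joint continuity of the derivatives *)

Section Multilinear.
Context {R : realType} {F G : metricFrechet R}.

Definition upd {T : Type} k (c : 'I_k -> T) (i : 'I_k) (x : T) : 'I_k -> T :=
  fun j => if j == i then x else c j.

Definition multilinear k (M : ('I_k -> F) -> G) :=
  forall c i, linear (fun x => M (upd c i x)).

Lemma curry_iter_linear r k (a : R) (M N : ('I_k -> F) -> G) :
  curry_iter r (fun h => a *: M h + N h) = a *: curry_iter r M + curry_iter r N.
Proof. by elim: k M N => [|k IH] M N //=; apply/funext => x; rewrite IH. Qed.

Lemma curry_iter_inj r k (M N : ('I_k -> F) -> G) :
  curry_iter r M = curry_iter r N -> forall h, M h = N h.
Proof.
elim: k M N => [|k IH] M N /=.
  by move=> MN h; rewrite (_ : h = fun=> 0)//; apply/funext => -[].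
move=> MN h; have {MN}/IH := congr1 (fun X => X (h ord0)) MN.
move=> /(_ (fun i => h (lift ord0 i))).
suff -> : fcons (h ord0) (fun i => h (lift ord0 i)) = h by [].
by apply/funext => i; rewrite /fcons; case: unliftP => [j ->|->].
Qed.

(** Linearity of the curried map in its first argument, with values in a space
of functions, is linearity pointwise in all other arguments. *)
Lemma carrier_multilinear r k (M : ('I_k -> F) -> G) :
  ms_carrier (curry_iter r M) -> multilinear M.
Proof.
elim: k M => [|k IH] M; first by move=> _ c [].
move=> [linM carM _] c i; have [j ->|->] := unliftP ord0 i.
  move=> a x y; have := IH _ (carM (c ord0)) (fun l => c (lift ord0 l)) j a x y.
  have updE z : fcons (c ord0) (upd (fun l => c (lift ord0 l)) j z) = upd c (lift ord0 j) z.
    apply/funext => l; rewrite /fcons /upd; case: unliftP => [m ->|->].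
      by rewrite (inj_eq lift_inj).
    by rewrite (negbTE (neq_lift _ _)).
  by rewrite !updE.
move=> a x y; have /= := linM a x y; rewrite -curry_iter_linear => /curry_iter_inj.
move=> /(_ (fun l => c (lift ord0 l))).
suff updE z : fcons z (fun l => c (lift ord0 l)) = upd c ord0 z by rewrite !updE.
apply/funext => l; rewrite /fcons /upd; case: unliftP => [m ->|->]; last by rewrite eqxx.
by rewrite eq_sym (negbTE (neq_lift _ _)).
Qed.

(** The telescoping sum behind the product rule. *)
Lemma multilinear_telescope k (M : ('I_k -> F) -> G) (a b : 'I_k -> F) :
  multilinear M ->
  M b - M a = \sum_(i < k)
    M (upd (fun j => if (j < i)%N then b j else a j) i (b i - a i)).
Proof.
move=> linM; pose hyb (n : nat) : 'I_k -> F := fun j => if (j < n)%N then b j else a j.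
have -> : M b - M a = \sum_(0 <= n < k) (M (hyb n.+1) - M (hyb n)).
  rewrite telescope_sumr//; congr (M _ - M _); apply/funext => j; rewrite /hyb ?ltn_ord//.
rewrite big_mkord; apply: eq_bigr => i _.
rewrite (linB (linM (hyb i) i)); congr (M _ - M _); apply/funext => j; rewrite /hyb /upd.
  by have [->|ji] := eqVneq j i; [rewrite ltnSn|rewrite ltnS leq_eqVlt val_eqE (negbTE ji)].
by have [->|//] := eqVneq j i; rewrite ltnn.
Qed.

End Multilinear.

Lemma cvg_ptws {S : Type} (Fl : set_system S) {FF : Filter Fl} k (T : uniformType)
    (H : S -> 'I_k -> T) (h : 'I_k -> T) :
  (forall i, H ^~ i @ Fl --> h i) ->
  (H : S -> {ptws 'I_k -> T}) @ Fl --> (h : {ptws 'I_k -> T}).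
Proof.
move=> Hi; apply/cvg_sup => i; apply/cvg_image.
  by rewrite eqEsubset; split => // y _; exists (fun=> y).
move=> A nA; exists (@^~ i @^-1` A); first exact: Hi nA.
by rewrite eqEsubset; split => [y [u + <-]//|y Ay]; exists (fun=> y).
Qed.

Lemma ptws_eval_cvg k (T : uniformType) (h : {ptws 'I_k -> T}) i :
  (fun u : {ptws 'I_k -> T} => u i) @ nbhs h --> h i.
Proof. exact: (@proj_continuous _ (fun _ : 'I_k => T) i h). Qed.

(** Joint continuity and the recursion for the derivatives, along arbitrary
filters: this is the form in which [smooth] is used. *)
Section SmoothFilters.
Context {R : realType} {F G : metricFrechet R}.
Variables (A : set F) (f : F -> G).
Hypothesis openA : open A.
Hypothesis smf : smooth A f.

Definition snoc {T : Type} k (h : 'I_k -> T) (v : T) : 'I_k.+1 -> T :=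
  fun i => if unlift ord_max i is Some j then h j else v.

Lemma snoc_widen {T : Type} k (h : 'I_k -> T) v :
  snoc h v \o widen_ord (leqnSn k) = h.
Proof.
apply/funext => i; rewrite /snoc /= (_ : widen_ord _ i = lift ord_max i) ?liftK//.
by apply/val_inj; rewrite /= /bump leqNgt ltn_ord.
Qed.

Lemma snoc_max {T : Type} k (h : 'I_k -> T) v : snoc h v ord_max = v.
Proof. by rewrite /snoc unlift_none. Qed.

Lemma Dn_cvg {S : Type} (Fl : set_system S) {FF : Filter Fl} k
    (X : S -> F) (H : S -> 'I_k -> F) (x : F) (h : 'I_k -> F) :
  A x -> X @ Fl --> x -> (forall i, H ^~ i @ Fl --> h i) ->
  (fun s => Dn f (X s) (H s)) @ Fl --> Dn f x h.
Proof.
move=> Ax Xx Hh; have [_ /subspace_continuousP/(_ (x, h) Ax) C] := smf (leqnn k).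
have XH : (fun s => (X s, H s : {ptws 'I_k -> F})) @ Fl -->
    within [set z : F * {ptws 'I_k -> F} | A z.1] (nbhs (x, h : {ptws 'I_k -> F})).
  move=> B; rewrite /within /= => nB.
  have {}nB : \forall s \near Fl, A (X s) -> B (X s, H s).
    exact: (cvg_pair Xx (cvg_ptws Hh) nB).
  have nA : \forall s \near Fl, A (X s) by apply: Xx; exact: open_nbhs_nbhs.
  by apply: filterS (filterI nB nA) => s [/= b a]; exact: b.
exact: cvg_comp XH C.
Qed.

Lemma Dn_derivative k (x : F) (h : 'I_k -> F) v : A x ->
  has_derivative (fun w => Dn f w h) x v (Dn f x (snoc h v)).
Proof.
move=> Ax; rewrite /= snoc_widen snoc_max; apply: Dderivable_has.
case: k h => [|k] h.
  have [/(_ x Ax)[+ _] _] := smf (leqnn 1%N); exact.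
have [/= H _] := smf (leqnn k.+2); exact: H.
Qed.

End SmoothFilters.

(** * Smoothness of an inverse map *)

Section ChainRules.
Context {R : realType} {F G : metricFrechet R}.
Variables (pF : nat -> F -> R) (pG : nat -> G -> R) (A : set F) (f : F -> G).
Hypothesis gpF : grading pF.
Hypothesis gpG : grading pG.
Hypothesis msizeZ_le : forall (l : R) (v : F), 0 <= l <= 1 -> msize (l *: v) <= msize v.
Hypothesis openA : open A.
Hypothesis smf : smooth A f.
Hypothesis multi : forall k x, A x -> multilinear (@Dn R F G f k x).

Lemma snoc_upd {T : Type} k (h : 'I_k -> T) u v :
  upd (snoc h u) ord_max v = snoc h v.
Proof.
apply/funext => i; rewrite /upd /snoc; case: unliftP => [j ->|->]; last by rewrite eqxx.
by rewrite eq_sym (negbTE (neq_lift _ _)).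
Qed.

Lemma snoc_linear k x (h : 'I_k -> F) : A x -> linear (fun v => Dn f x (snoc h v)).
Proof. by move=> Ax a u v; have := multi Ax (snoc h 0) ord_max a u v; rewrite !snoc_upd. Qed.

Lemma snoc_cvg {S : Type} (Fl : set_system S) {FF : Filter Fl} k
    (H : S -> 'I_k -> F) (h : 'I_k -> F) (W : S -> F) (v : F) :
  (forall i, H ^~ i @ Fl --> h i) -> W @ Fl --> v ->
  forall i, (fun s => snoc (H s) (W s) i) @ Fl --> snoc h v i.
Proof. by move=> Hh Wv i; rewrite /snoc; case: unliftP => [j _|_]. Qed.

(** The mean value inequality needs the derivative at every point of the
segment from [x] to [X t] at once. It is enough to control one point per [t],
chosen to be bad whenever the segment has a bad point. *)
Lemma Dn_chain k (X : R -> F) (H : R -> 'I_k -> F) x h v : A x ->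
  (fun t => t^-1 *: (X t - x)) @ 0^' --> v -> (forall i, H ^~ i @ 0^' --> h i) ->
  (fun t => t^-1 *: (Dn f (X t) (H t) - Dn f x (H t))) @ 0^' --> Dn f x (snoc h v).
Proof.
move=> Ax Xv Hh; set L := Dn f x (snoc h v).
have Xx := cvg_of_quotient gpF Xv.
apply/(grading_cvgP gpG) => m e e0; have cp := grading_cseminorm m gpG; have sp := cp.1.
pose good t s := A (x + s *: (X t - x)) /\
  pG m (Dn f (x + s *: (X t - x)) (snoc (H t) (t^-1 *: (X t - x))) - L) < e / 2.
have /choice[sel Hsel] : forall t, exists s : R, 0 <= s <= 1 /\
    (good t s -> forall s', 0 <= s' <= 1 -> good t s').
  move=> t; have [[s [s01 ngood]]|all] := pselect (exists s, 0 <= s <= 1 /\ ~ good t s).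
    by exists s.
  exists 0; rewrite lexx ler01; split=> // _ s' s'01.
  by apply: contrapT => ng; apply: all; exists s'.
have Yx : (fun t => x + sel t *: (X t - x)) @ 0^' --> x.
  apply/cvg_msizeP => d d0; move/cvg_msizeP/(_ d d0) : Xx; apply: filterS => t.
  by rewrite addrAC subrr add0r; apply: le_lt_trans; exact: msizeZ_le (Hsel t).1.
have goodsel : \forall t \near 0^', good t (sel t).
  apply: filterI; first by apply: Yx; exact: open_nbhs_nbhs.
  have e20 : 0 < e / 2 by rewrite divr_gt0.
  have cD : (fun t => Dn f (x + sel t *: (X t - x))
      (snoc (H t) (t^-1 *: (X t - x)))) @ 0^' --> L.
    by apply: (Dn_cvg openA smf Ax Yx); exact: snoc_cvg.
  exact: (cseminorm_cvg cp cD e20).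
apply: filterS (filterI goodsel near_dnbhs0_neq) => t [/(Hsel t).2 all t0].
have tn0 : 0 < `|t| by rewrite normr_gt0.
have := @mean_value_line _ _ _ cp _ (fun w => Dn f w (H t))
  (fun s => Dn f (x + s *: (X t - x)) (snoc (H t) (X t - x))) x (X t - x)
  (t *: L) (`|t| * (e / 2)).
rewrite subrKC => mv.
have {}mv : pG m (Dn f (X t) (H t) - Dn f x (H t) - t *: L) <= `|t| * (e / 2).
  apply: mv => s s01; have [As small] := all s s01; first exact: Dn_derivative.
  have <- : t *: Dn f (x + s *: (X t - x)) (snoc (H t) (t^-1 *: (X t - x))) =
      Dn f (x + s *: (X t - x)) (snoc (H t) (X t - x)).
    by rewrite -(linZ (snoc_linear (H t) As)) scalerA mulfV// scale1r.
  by rewrite -scalerBr (snormZ sp) ler_wpM2l// ltW.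
have -> : t^-1 *: (Dn f (X t) (H t) - Dn f x (H t)) - L =
    t^-1 *: (Dn f (X t) (H t) - Dn f x (H t) - t *: L).
  by rewrite [RHS]scalerBr scalerA mulVf// scale1r.
rewrite (snormZ sp) normfV mulrC ltr_pdivrMr//; apply: le_lt_trans mv _; nra.
Qed.

Lemma Dn_product k (H : R -> 'I_k -> F) x h h' : A x ->
  (forall i, (fun t => t^-1 *: (H t i - h i)) @ 0^' --> h' i) ->
  (fun t => t^-1 *: (Dn f x (H t) - Dn f x h)) @ 0^' -->
    \sum_(i < k) Dn f x (upd h i (h' i)).
Proof.
move=> Ax Hh.
have Hc i : H ^~ i @ 0^' --> h i by exact: cvg_of_quotient gpF (Hh i).
pose hyb t (i j : 'I_k) := if (j < i)%N then H t j else h j.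
apply: (@mcvg_near _ _ _ _ _ (fun t => \sum_(i < k)
  Dn f x (upd (hyb t i) i (t^-1 *: (H t i - h i))))).
  apply: nearW => t; rewrite (multilinear_telescope _ _ (multi Ax)) scaler_sumr.
  by apply: eq_bigr => i _; rewrite (linZ (multi Ax (hyb t i) i)).
apply: mcvg_sum => i; apply: (Dn_cvg openA smf Ax); first exact: cvg_cst.
move=> j.
rewrite /upd; case: eqP => _; first exact: Hh.
by rewrite /hyb; case: (j < i)%N; [exact: Hc|exact: cvg_cst].
Qed.

Variable B : F -> G -> F.
Hypothesis B_linear : forall x, A x -> linear (B x).
Hypothesis B_left : forall x v, A x -> B x (Dn f x (fun _ : 'I_1 => v)) = v.
Hypothesis B_right : forall x w, A x -> Dn f x (fun _ : 'I_1 => B x w) = w.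
Hypothesis B_cvg : forall (S : Type) (Fl : set_system S), Filter Fl ->
  forall (X : S -> F) (W : S -> G) x w, A x -> X @ Fl --> x -> W @ Fl --> w ->
  (fun s => B (X s) (W s)) @ Fl --> B x w.

(** The rule [(M^-1)' = - M^-1 M' M^-1] for the inverse of a matrix, with [B x]
the inverse of the derivative of [f] at [x]. *)
Lemma B_derivative (X : R -> F) (W : R -> G) x w v w' : A x ->
  (fun t => t^-1 *: (X t - x)) @ 0^' --> v ->
  (fun t => t^-1 *: (W t - w)) @ 0^' --> w' ->
  (fun t => t^-1 *: (B (X t) (W t) - B x w)) @ 0^' -->
    B x (w' - Dn f x (snoc (fun _ : 'I_1 => B x w) v)).
Proof.
move=> Ax Xv Ww; have Xx := cvg_of_quotient gpF Xv.
have nA : \forall t \near 0^', A (X t) by apply: Xx; exact: open_nbhs_nbhs.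
pose q : 'I_1 -> F := fun=> B x w.
have ch : (fun t => t^-1 *: (Dn f (X t) q - Dn f x q)) @ 0^' --> Dn f x (snoc q v).
  by apply: (@Dn_chain _ X (fun=> q)) => // i; exact: cvg_cst.
have cB : (fun t => B (X t) (t^-1 *: (W t - w) -
    t^-1 *: (Dn f (X t) q - Dn f x q))) @ 0^' --> B x (w' - Dn f x (snoc q v)).
  by apply: B_cvg => //; exact: mcvgB.
apply: mcvg_near cB.
apply: filterS nA => t At.
rewrite -scalerBr (linZ (B_linear At)); congr (_ *: _).
rewrite !(linB (B_linear At)) (B_left _ At) B_right// opprB.
by rewrite subrKA.
Qed.

Variables (V : set G) (g : G -> F).
Hypothesis openV : open V.
Hypothesis gA : forall y, V y -> A (g y).
Hypothesis g_cont : forall y, V y -> g @ y --> g y.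
Hypothesis g_derivative : forall y w, V y -> has_derivative g y w (B (g y) w).

(** The derivatives of [g] at [y] are [B (g y)] applied to these expressions in
[y] and the directions [h 0], [h 1], and so on. The directions form a sequence,
so that one class serves the derivatives of all orders. *)
Inductive inverse_expr : (G -> (nat -> G) -> G) -> Prop :=
| expr_dir i : inverse_expr (fun _ h => h i)
| expr_zero : inverse_expr (fun _ _ => 0)
| expr_add T T' : inverse_expr T -> inverse_expr T' ->
    inverse_expr (fun y h => T y h + T' y h)
| expr_opp T : inverse_expr T -> inverse_expr (fun y h => - T y h)
| expr_node m (Ts : 'I_m -> G -> (nat -> G) -> G) :
    (forall i, inverse_expr (Ts i)) ->
    inverse_expr (fun y h => Dn f (g y) (fun i => B (g y) (Ts i y h))).

Lemma expr_sum (I : Type) (r : seq I) (Ts : I -> G -> (nat -> G) -> G) :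
  (forall i, inverse_expr (Ts i)) ->
  inverse_expr (fun y h => \sum_(i <- r) Ts i y h).
Proof.
move=> HT; elim: r => [|i r IH].
  rewrite (_ : (fun _ => _) = fun _ _ => 0); first exact: expr_zero.
  by apply/funext => y; apply/funext => h; rewrite big_nil.
rewrite (_ : (fun _ => _) = fun y h => Ts i y h + \sum_(i <- r) Ts i y h).
  exact: expr_add.
by apply/funext => y; apply/funext => h; rewrite big_cons.
Qed.

Lemma g_cvg {S : Type} (Fl : set_system S) {FF : Filter Fl} (Y : S -> G) y :
  V y -> Y @ Fl --> y -> (fun s => g (Y s)) @ Fl --> g y.
Proof. by move=> Vy Yy; exact: cvg_comp Yy (g_cont Vy). Qed.

Lemma expr_cvg T : inverse_expr T ->
  forall (S : Type) (Fl : set_system S), Filter Fl ->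
  forall (Y : S -> G) (H : S -> nat -> G) y h, V y ->
  Y @ Fl --> y -> (forall i, H ^~ i @ Fl --> h i) ->
  (fun s => T (Y s) (H s)) @ Fl --> T y h.
Proof.
move=> HT S Fl FF Y H y h Vy Yy Hh; elim: HT => [i||T1 T2 _ IH1 _ IH2|T1 _ IH|m Ts _ IH].
- exact: Hh.
- exact: cvg_cst.
- exact: mcvgD.
- exact: mcvgN.
apply: (Dn_cvg openA smf (gA Vy)); first exact: g_cvg.
by move=> i; apply: B_cvg; [exact: gA|exact: g_cvg|exact: IH].
Qed.

Lemma B_expr_step T T' j : inverse_expr T -> inverse_expr T' ->
  (forall y h, V y -> has_derivative (fun z => T z h) y (h j) (T' y h)) ->
  exists2 T'', inverse_expr T'' & forall y h, V y ->
    has_derivative (fun z => B (g z) (T z h)) y (h j) (B (g y) (T'' y h)).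
Proof.
move=> HT HT' DT'; exists (fun y h => T' y h - Dn f (g y)
  (fun l : 'I_2 => B (g y) (snoc (fun _ : 'I_1 => T) (fun _ h => h j) l y h))).
  apply: expr_add => //; apply: expr_opp; apply: expr_node => l.
  by rewrite /snoc; case: unliftP => [_ _|_]; [exact: HT|exact: expr_dir].
move=> y h Vy.
have := @B_derivative (fun t => g (y + t *: h j)) (fun t => T (y + t *: h j) h)
  (g y) (T y h) (B (g y) (h j)) (T' y h) (gA Vy) (g_derivative Vy) (DT' y h Vy).
rewrite /has_derivative; congr (_ --> B _ (_ - Dn f _ _)).
by apply/funext => l; rewrite /snoc; case: unliftP.
Qed.

(** Only the nodes need work. With [X t = g (y + t *: h j)], the derivative of
[Dn f (X t) (H t)] is the sum of the contribution of [X] and of one contribution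
per argument, by multilinearity; each is again a node. *)
Lemma expr_derivative T : inverse_expr T -> forall j,
  exists2 T', inverse_expr T' &
    forall y h, V y -> has_derivative (fun z => T z h) y (h j) (T' y h).
Proof.
move=> HT j; elim: HT => [i||T1 T2 _ [T1' H1 D1] _ [T2' H2 D2]|T1 _ [T1' H1 D1]|m Ts HTs IH].
- exists (fun _ _ => 0); first exact: expr_zero.
  move=> y h Vy; apply: mcvg_near (cvg_cst (0 : G)).
  by apply: nearW => t; rewrite /diff_quotient subrr scaler0.
- exists (fun _ _ => 0); first exact: expr_zero.
  move=> y h Vy; apply: mcvg_near (cvg_cst (0 : G)).
  by apply: nearW => t; rewrite /diff_quotient subrr scaler0.
- exists (fun y h => T1' y h + T2' y h); first exact: expr_add.
  move=> y h Vy; apply: mcvg_near (mcvgD (D1 y h Vy) (D2 y h Vy)).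
  by apply: nearW => t; rewrite /diff_quotient -scalerDr opprD addrACA.
- exists (fun y h => - T1' y h); first exact: expr_opp.
  move=> y h Vy; apply: mcvg_near (mcvgN (D1 y h Vy)).
  by apply: nearW => t; rewrite /diff_quotient -scalerN opprD.
have /choice[Ts' HTs'] : forall i, exists T', inverse_expr T' /\
    forall y h, V y -> has_derivative (fun z => B (g z) (Ts i z h)) y (h j) (B (g y) (T' y h)).
  move=> i; have [T' eT' DT'] := IH i.
  by have [T'' ? ?] := B_expr_step (HTs i) eT' DT'; exists T''.
exists (fun y h =>
  Dn f (g y) (fun l => B (g y) (snoc Ts (fun _ h => h j) l y h)) +
  \sum_(i < m) Dn f (g y) (fun l => B (g y) (upd Ts i (Ts' i) l y h))).
  apply: expr_add.
    apply: expr_node => l; rewrite /snoc.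
    by case: unliftP => [k _|_]; [exact: HTs|exact: expr_dir].
  apply: expr_sum => i; apply: expr_node => l; rewrite /upd.
  by case: eqP => _; [exact: (HTs' i).1|exact: HTs].
move=> y h Vy; have Ax := gA Vy; set x := g y in Ax *.
pose X t := g (y + t *: h j); pose H t i := B (X t) (Ts i (y + t *: h j) h).
pose h0 i := B x (Ts i y h).
have Hh i : (fun t => t^-1 *: (H t i - h0 i)) @ 0^' --> B x (Ts' i y h).
  exact: (HTs' i).2.
have Hc i : H ^~ i @ 0^' --> h0 i by exact: cvg_of_quotient gpF (Hh i).
have P1 := Dn_chain Ax (g_derivative Vy : (fun t => t^-1 *: (X t - x)) @ 0^' --> _) Hc.
have P2 := Dn_product Ax Hh.
have -> : Dn f x (fun l => B x (snoc Ts (fun _ h => h j) l y h)) =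
    Dn f x (snoc h0 (B x (h j))).
  by congr (Dn f x _); apply/funext => l; rewrite /snoc; case: unliftP.
have -> : \sum_(i < m) Dn f x (fun l => B x (upd Ts i (Ts' i) l y h)) =
    \sum_(i < m) Dn f x (upd h0 i (B x (Ts' i y h))).
  apply: eq_bigr => i _; congr (Dn f x _); apply/funext => l.
  by rewrite /upd; case: eqP.
apply: mcvg_near (mcvgD P1 P2); apply: nearW => t.
by rewrite -scalerDr subrKA.
Qed.

Lemma has_derivative_near (Q Q' : G -> F) y w l :
  (\forall z \near y, Q z = Q' z) -> has_derivative Q y w l -> has_derivative Q' y w l.
Proof.
move=> QQ; apply: mcvg_near.
have yc := @line_cvg _ _ _ y w gpG.
have Qy := nbhs_singleton QQ.
have Qt : \forall t \near (0 : R)^', Q (y + t *: w) = Q' (y + t *: w).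
  exact: (yc [set z | Q z = Q' z] QQ).
by apply: filterS Qt => t {}Qt; rewrite /diff_quotient Qt Qy.
Qed.

Lemma B_expr_derivative T : inverse_expr T -> forall j,
  exists2 T', inverse_expr T' & forall y h, V y ->
    has_derivative (fun z => B (g z) (T z h)) y (h j) (B (g y) (T' y h)).
Proof.
by move=> HT j; have [T' HT' DT'] := expr_derivative HT j; exact: B_expr_step HT' DT'.
Qed.

Lemma Dn_inverse k : exists2 T, inverse_expr T & forall y (h : nat -> G), V y ->
  Dn g y (fun i : 'I_k.+1 => h i) = B (g y) (T y h).
Proof.
elim: k => [|k [T HT IH]].
  exists (fun _ h => h 0); first exact: expr_dir.
  by move=> y h Vy; rewrite /= (DderiveE (g_derivative Vy)).
have [T' HT' DT'] := B_expr_derivative HT k.+1.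
exists T' => // y h Vy; apply: DderiveE; apply: has_derivative_near (DT' y h Vy).
have : \forall z \near y, V z by exact: open_nbhs_nbhs.
by apply: filterS => z Vz; rewrite -IH.
Qed.

(** [Dn_inverse] expresses all derivatives of [g] by expressions, which are
differentiable and jointly continuous. *)
Theorem smooth_inverse : smooth V g.
Proof.
move=> _ k _; split.
  case: k => [|[|k]] //= y Vy.
    split=> [v|]; first by exists (B (g y) v); exact: g_derivative.
    move=> a u v; rewrite !(DderiveE (g_derivative Vy)).
    by rewrite (B_linear (gA Vy)).
  move=> h v; have [T HT TE] := Dn_inverse k.
  have [T' _ DT'] := B_expr_derivative HT k.+1.
  pose h' (i : nat) := if insub i is Some j then h j else v.
  have h'E : h = fun i : 'I_k.+1 => h' i by apply/funext => i; rewrite /h' valK.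
  have vE : v = h' k.+1 by rewrite /h' insubN// ltnn.
  exists (B (g y) (T' y h')); rewrite vE; apply: has_derivative_near (DT' y h' Vy).
  have : \forall z \near y, V z by exact: open_nbhs_nbhs.
  by apply: filterS => z Vz; rewrite -TE// -h'E.
apply/subspace_continuousP => -[y h] /= Vy.
pose N := nbhs ((y, h) : G * {ptws 'I_k -> G}).
pose D := [set z : G * {ptws 'I_k -> G} | V z.1].
have inN (T : topologicalType) (X : G * {ptws 'I_k -> G} -> T) (l : T) :
    X @ N --> l -> X @ within D N --> l.
  by apply: cvg_trans; apply: cvg_app; rewrite /N; exact: cvg_within.
have fstc : (fun z => z.1) @ within D N --> y by apply: inN; exact: cvg_fst.
have sndc i : (fun z => z.2 i) @ within D N --> h i.
  by apply: inN; apply: cvg_comp (@ptws_eval_cvg _ _ h i); exact: cvg_snd.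
move: h @N @D inN fstc sndc; case: k => [|k] h N D inN fstc sndc; first exact: g_cvg.
have [T HT TE] := Dn_inverse k.
pose ext (u : 'I_k.+1 -> G) (i : nat) := if insub i is Some j then u j else 0.
have extE (u : 'I_k.+1 -> G) : u = fun i : 'I_k.+1 => ext u i.
  by apply/funext => i; rewrite /ext valK.
have DnE z : V z.1 -> Dn g z.1 z.2 = B (g z.1) (T z.1 (ext z.2)).
  by move=> Vz; rewrite [in LHS](extE z.2) TE.
rewrite [X in _ --> X](DnE (y, h))//.
apply: (@mcvg_near _ _ _ _ _ (fun z : G * {ptws 'I_k.+1 -> G} => B (g z.1) (T z.1 (ext z.2)))).
  by rewrite near_withinE; apply: nearW => z Vz; exact/esym/DnE.
apply: B_cvg; [exact: gA|exact: g_cvg|apply: expr_cvg => // i].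
by rewrite /ext; case: insubP => [j _ _|_]; [exact: sndc|exact: cvg_cst].
Qed.

End ChainRules.

(** * From the hypotheses on f to a map near the identity *)

Section BsmoothBounds.
Context {R : realType} {F G : metricFrechet R}.

Lemma has_derivative_linear {E : metricFrechet R} (L : G -> E) (Q : F -> G) x v l :
  linear L -> continuous L -> has_derivative Q x v l ->
  has_derivative (fun z => L (Q z)) x v (L l).
Proof.
move=> lL cL H.
have LH : (fun t => L (diff_quotient Q x v t)) @ 0^' --> L l by exact: cvg_comp H (cL l).
move: LH; by apply: mcvg_near; apply: nearW => t; rewrite /= (linZ lL) (linB lL).
Qed.

Lemma snoc_const (q : F) : snoc (fun i : 'I_0 => 0) q = fun=> q.
Proof. by apply/funext => i; rewrite /snoc; case: unliftP => [[]|]. Qed.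

Lemma snoc_pair (q v : F) : snoc (fun _ : 'I_1 => q) v = fcons q (fcons v (fun=> 0)).
Proof.
apply/funext => i; rewrite /snoc /fcons; case: unliftP => [j ->|->].
  case: unliftP => [k /(congr1 val)|//] /=; by rewrite (ord1 j).
by case: unliftP => [k _|/(congr1 val)//]; rewrite (ord1 k) unlift_none.
Qed.

Lemma snoc_upd_first (q q' v : F) :
  upd (snoc (fun _ : 'I_1 => q') v) (lift ord_max ord0) q = snoc (fun _ : 'I_1 => q) v.
Proof.
apply/funext => i; rewrite /upd /snoc; case: unliftP => [j ->|->].
  by rewrite (ord1 j) eqxx.
by rewrite (negbTE (neq_lift _ _)).
Qed.

(** What the second-order theory needs from [bsmooth]: bounds near [x0] for
the first two derivatives, in terms of the metrics. *)
Lemma bsmooth_bounds (U : set F) (f : F -> G) (x0 : F) : open U -> U x0 -> bsmooth U f ->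
  exists2 r : R, 0 < r &
   (forall eps, 0 < eps -> \forall u \near x0, forall q, msize q < r ->
     msize (Dn f u (fun _ : 'I_1 => q) - Dn f x0 (fun _ : 'I_1 => q)) <= eps * msize q) /\
   (exists2 C : R, 0 < C & \forall u \near x0, forall q v, msize q < r -> msize v < r ->
     msize (Dn f u (snoc (fun _ : 'I_1 => q) v)) <= C * msize q * msize v).
Proof.
move=> oU Ux0 [rho rho0 [_ bs]].
have [r r0 rrho] : exists2 r : R, 0 < r & (r%:E <= rho)%E.
  case: rho rho0 {bs} => [s|_|//]; first by rewrite lte_fin => s0; exists s.
  by exists 1 => //; rewrite leey.
have lt_rho (q : F) : msize q < r -> ((msize q)%:E < rho)%E.
  by move=> qr; apply: lt_le_trans rrho; rewrite lte_fin.
have nU : \forall u \near x0, U u by exact: open_nbhs_nbhs.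
have near_dist k e : (0 < k)%N -> 0 < e -> \forall u \near x0, U u /\
    ms_dist (Dn_linear f rho k u) (Dn_linear f rho k x0) < e.
  move=> k0 e0; have [_ /(_ x0 Ux0)/cvgrPdist_lt/(_ e e0)] := bs k k0.
  rewrite near_withinE => H; apply: filterS (filterI nU H) => u [Uu /(_ Uu)].
  by rewrite sub0r normrN => ?; split=> //; apply: le_lt_trans (ler_norm _) _.
have fcE (q : F) : fcons q (fun=> 0) = (fun _ : 'I_1 => q).
  by apply/funext => i; rewrite /fcons (ord1 i) unlift_none.
have car k u : (0 < k)%N -> U u -> ms_carrier (Dn_linear f rho k u).
  by move=> k0 Uu; have [+ _] := bs k k0; apply.
have multi k u : (0 < k)%N -> U u -> multilinear (@Dn R F G f k u).
  by move=> k0 Uu; apply: (@carrier_multilinear _ _ _ rho); exact: car.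
exists r => //; split.
  move=> eps eps0; apply: filterS (near_dist 1%N eps isT eps0) => u [Uu du] q qr.
  have [->|q0] := eqVneq q 0.
    have zero w : U w -> Dn f w (fun _ : 'I_1 => 0 : F) = 0.
      move=> Uw; rewrite (_ : (fun=> 0) = upd (fun _ : 'I_1 => 0 : F) ord0 0).
        by rewrite (lin0 (multi 1%N w isT Uw _ _)).
      by apply/funext => i; rewrite /upd; case: ifP.
    by rewrite !zero// subrr !msize0 mulr0.
  have := ms_dist_bound (@subadditive_full _ G) (car 1%N u isT Uu) (car 1%N x0 isT Ux0) q0 (lt_rho _ qr).
  rewrite /Dn_linear /= fcE => H; apply: le_trans H _.
  by rewrite ler_wpM2r ?msize_ge0// ltW.
pose K := fine (bracket rho (Dn_linear f rho 2 x0 : F -> _)).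
have K0 : 0 <= K by rewrite fine_ge0// /bracket le_max lexx.
exists (K + 1); first by rewrite ltr_wpDl.
apply: filterS (near_dist 2 1 isT ltr01) => u [Uu du] q v qr vr.
have mu := multi 2 u isT Uu.
have [->|q0] := eqVneq q 0.
  by rewrite -(snoc_upd_first 0 0) (lin0 (mu _ _)) !msize0 mulr0 mul0r.
have [->|v0] := eqVneq v 0.
  by rewrite -(snoc_upd _ 0) (lin0 (mu _ _)) !msize0 mulr0.
have cu := car 2 u isT Uu; have c0 := car 2 x0 isT Ux0.
have sG := @subadditive_full _ G.
have [_ cuq _] := cu; have [_ c0q c0b] := c0.
have := bracket_bound c0b q0 (lt_rho _ qr).
have := ms_dist_bound (subadditive_Bspace sG) cu c0 q0 (lt_rho _ qr).
set X := Dn_linear f rho 2 u q; set Y := Dn_linear f rho 2 x0 q => XY Y0.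
have cX : ms_carrier X by exact: cuq.
have cY : ms_carrier Y by exact: c0q.
have XYv := ms_dist_bound sG cX cY v0 (lt_rho _ vr).
have [_ _ bY] := cY; have Yv := bracket_bound bY v0 (lt_rho _ vr).
have XYE : ms_dist (X - Y) 0 = ms_dist X Y by rewrite /= subr0.
have Y0E : ms_dist Y 0 = fine (bracket rho (Y : F -> _)) by rewrite /= subr0.
rewrite snoc_pair.
have triangle : msize (X v) <= msize (X v - Y v) + msize (Y v).
  by rewrite -[X in msize X <= _](subrK (Y v)) msizeD.
apply: le_trans triangle _.
have sq := msize_ge0 q; have sv := msize_ge0 v.
have XYq : ms_dist X Y <= msize q.
  rewrite -XYE; apply: le_trans XY _; rewrite -[leRHS]mul1r.
  by rewrite ler_wpM2r// ltW.
have Yq : fine (bracket rho (Y : F -> _)) <= K * msize q by rewrite -Y0E.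
have -> : (K + 1) * msize q * msize v = msize q * msize v + K * msize q * msize v by ring.
apply: lerD; first by apply: le_trans XYv _; rewrite ler_wpM2r.
by apply: le_trans Yv _; rewrite ler_wpM2r.
Qed.

End BsmoothBounds.

Section Chart.
Context {R : realType} {F G : metricFrechet R}.
Variables (p : nat -> F -> R) (U : set F) (f : F -> G) (x0 : F) (B0 : G -> F) (c : R).
Hypothesis gp : grading p.
Hypothesis openU : open U.
Hypothesis Ux0 : U x0.
Hypothesis bsf : bsmooth U f.
Hypothesis linB0 : linear B0.
Hypothesis contB0 : continuous B0.
Hypothesis c0 : 0 < c.
Hypothesis B0_bound : forall w, msize (B0 w) <= c^-1 * msize w.
Hypothesis B0_left : forall v, B0 (Dn f x0 (fun _ : 'I_1 => v)) = v.

Let smf : smooth U f. Proof. by case: bsf => r _ []. Qed.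

Lemma bsmooth_multilinear k x : U x -> multilinear (@Dn R F G f k x).
Proof.
move=> Ux; case: k => [|k]; first by move=> h [].
have [r _ [_ /(_ k.+1 isT)[/(_ x Ux) H _]]] := bsf.
exact: carrier_multilinear H.
Qed.

Lemma Dn1_derivative x v : U x -> has_derivative f x v (Dn f x (fun _ : 'I_1 => v)).
Proof. by move=> Ux; have := @Dn_derivative _ _ _ _ _ smf 0 x (fun=> 0) v Ux; rewrite snoc_const. Qed.

Lemma Dn1_linear x : U x -> linear (fun v => Dn f x (fun _ : 'I_1 => v)).
Proof.
move=> Ux a v w; have := @snoc_linear _ _ _ _ _ bsmooth_multilinear 0 x (fun=> 0) Ux a v w.
by rewrite !snoc_const.
Qed.

(** The estimate for [phi1] with respect to [bar] comes from the one in the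
metric: if the difference of the derivatives is small enough compared to [r],
it maps the unit ball of [bar] into half of it. *)
Lemma near_identity_chart : exists bar W r C,
  [/\ near_identity bar (B0 \o f) (fun x v => B0 (Dn f x (fun _ : 'I_1 => v)))
        (fun x q v => B0 (Dn f x (snoc (fun _ : 'I_1 => q) v))) W x0 r C,
      W `<=` U & nbhs x0 W].
Proof.
have [r r0 [near1 [C C0 near2]]] := bsmooth_bounds openU Ux0 bsf.
have [m [s s0 ball]] : exists m, exists2 s, 0 < s & forall v, p m v < s -> msize v < r.
  by case: gp => _ _; apply.
have sm := (grading_cseminorm m gp).1.
pose bar v := 2 / s * p m v.
have cbar : cseminorm bar by apply: cseminorm_scale (grading_cseminorm m gp); rewrite divr_gt0.
have sbar := cbar.1.
have bar_ball v : bar v <= 1 -> msize v < r.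
  by rewrite /bar mulrAC ler_pdivrMr// mul1r => H; apply: ball; lra.
have [eta eta0 Heta] := cbar.2 (1 / 2) (divr_gt0 ltr01 (ltr0Sn _ 1)).
(* The first bound makes [phi1 - id] halve sizes; the second makes it map vectors
   of size less than [r] to vectors of size less than [eta]. *)
pose eps := Num.min (c / 2) (c * eta / (2 * r)).
have eps0 : 0 < eps by rewrite lt_min !divr_gt0 ?mulr_gt0.
have eps1 : c^-1 * eps <= 1 / 2.
  by rewrite mulrC ler_pdivrMr// mul1r mulrC ge_min lexx.
have eps2 : c^-1 * eps * r < eta.
  have : eps <= c * eta / (2 * r) by rewrite ge_min lexx orbT.
  rewrite ler_pdivlMr ?mulr_gt0// => H.
  rewrite -mulrA mulrC ltr_pdivrMr//; have := mulr_gt0 c0 eta0; lra.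
have : nbhs x0 U by exact: open_nbhs_nbhs.
move/(filterI (filterI (near1 eps eps0) near2)) => /nbhs_msizeP[d d0 Hd].
have [m' [s' s'0 ball']] : exists m, exists2 s, 0 < s & forall v, p m v < s -> msize v < d.
  by case: gp => _ _; apply.
have sm' := (grading_cseminorm m' gp).1.
pose W := [set x | p m' (x - x0) < s'].
have WN x : W x -> _ := fun Wx => Hd x (ball' _ Wx).
have WU x : W x -> U x by move=> /WN[].
have psi_le x q : W x -> msize q < r ->
    msize (B0 (Dn f x (fun _ : 'I_1 => q)) - q) <= c^-1 * eps * msize q.
  move=> /WN[[H _] _] qr; rewrite -{2}[q]B0_left -(linB linB0).
  apply: le_trans (B0_bound _) _; rewrite -mulrA ler_wpM2l ?invr_ge0 ?(ltW c0)//.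
  exact: H.
have linp x : W x -> linear (fun v => B0 (Dn f x (fun _ : 'I_1 => v))).
  by move=> /WU Ux a v w; rewrite (Dn1_linear Ux) linB0.
exists bar, W, r, (c^-1 * C); split=> //; last first.
  have [e e0 He] := (grading_cseminorm m' gp).2 s' s'0.
  by apply/nbhs_msizeP; exists e => // y /He.
split=> //.
- by rewrite mulr_gt0// invr_gt0.
- move=> x y t Wx Wy /andP[t0 t1]; rewrite /W /=.
  rewrite segment_subr.
  apply: le_lt_trans (snormD sm' _ _) _.
  rewrite !(snormZ_ge0 sm')//; last by rewrite subr_ge0.
  move: Wx Wy; rewrite /W /=; set a := p m' (x - x0); set b := p m' (y - x0).
  by have [ab|/ltW ba] := leP a b; nra.
- by rewrite /W /= subrr (snorm0 sm').
- by move=> x v /WU Ux; apply: has_derivative_linear => //; exact: Dn1_derivative.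
- move=> x q v /WU Ux; apply: (has_derivative_linear (Q := fun w => Dn f w (fun _ : 'I_1 => q))) => //.
  exact: Dn_derivative.
- move=> x /WU Ux; have fx : f @ x --> f x.
    by apply: (@Dn_cvg _ _ _ _ _ openU smf _ (nbhs x) _ 0 id (fun=> fun=> 0) x (fun=> 0) Ux) => [|[]//]; exact: cvg_id.
  by apply: continuous_comp fx _; exact: contB0.
- move=> x v /WU Ux a q q'.
  have := bsmooth_multilinear Ux (snoc (fun _ : 'I_1 => 0) v) (lift ord_max ord0) a q q'.
  by rewrite !snoc_upd_first => ->; rewrite linB0.
- by move=> x q /WU Ux a v w; rewrite (snoc_linear bsmooth_multilinear)// linB0.
- move=> x q Wx qr; apply: le_trans (psi_le x q Wx qr) _.
  have := msize_ge0 q; nra.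
- move=> x q Wx; rewrite ler_pdivlMr// mulrC.
  apply: le_of_unit_ball; first exact: snorm_ge0.
  move=> t t0; rewrite -(snormZ_ge0 sbar _ (ltW t0)) => /bar_ball tq.
  rewrite mulrCA -(snormZ_ge0 sbar _ (ltW t0)).
  rewrite scalerBr -(linZ (linp x Wx)).
  suff /Heta : msize (B0 (Dn f x (fun _ : 'I_1 => t *: q)) - t *: q) < eta by lra.
  apply: le_lt_trans (psi_le _ _ Wx tq) _; apply: le_lt_trans eps2.
  by rewrite ler_wpM2l ?(ltW tq)// mulr_ge0 ?invr_ge0 ?ltW.
move=> x q v /WN[[_ H] _] qr vr; apply: le_trans (B0_bound _) _.
by rewrite -!mulrA ler_wpM2l ?invr_ge0 ?(ltW c0)// mulrA H.
Qed.

End Chart.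

(** * The inverse function theorem *)

Lemma smooth_subset {R : realType} {F G : metricFrechet R} (A U : set F) (f : F -> G) :
  A `<=` U -> smooth U f -> smooth A f.
Proof.
move=> AU smU i k ki; have [ex ct] := smU i k ki; split.
  by case: k {ki ct} ex => [|[|k]] //= ex u /AU; exact: ex.
by apply: continuous_subspaceW ct => z /AU.
Qed.

Theorem theorem4p7 (R : realType) (F G : metricFrechet R)
    (hF : sum_form F) (hG : sum_form G)
    (U : set F) (hU : open U) (x0 : F) (hx0 : U x0)
    (f : F -> G) (hf : bsmooth U f)
    (hiso : frechet_isomorphism (Dderive f x0))
    (hbd : bounded_from_0 (Dderive f x0)) :
  exists r0 : R,
    [/\ 0 < r0, mf_ball x0 r0 `<=` U, open (f @` mf_ball x0 r0)
      & diffeomorphism (mf_ball x0 r0) (f @` mf_ball x0 r0) f].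
Proof.
have [pF gpF] := sum_form_grading hF; have [pG gpG] := sum_form_grading hG.
have mono := sum_form_msizeZ hF.
have smU : smooth U f by case: hf => r _ [].
case: hiso => linL _ [B0 [LB BL contB0]]; case: hbd => c c0 hc.
set L := Dderive f x0 in linL LB BL hc.
have linB0 : linear B0 by move=> a u v; apply: (can_inj LB); rewrite BL linL !BL.
have B0_bound w : msize (B0 w) <= c^-1 * msize w.
  by rewrite mulrC ler_pdivlMr// mulrC -[w in leRHS]BL; exact: hc.
have [bar [W [r [C [NI WU nW]]]]] :=
  near_identity_chart gpF hU hx0 hf linB0 contB0 c0 B0_bound LB.
have fphi x : f x = L ((B0 \o f) x) by rewrite /= BL.
have [r0 r00 ballW] := (nbhs_msizeP _ _).1 nW.
pose A := mf_ball x0 r0.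
have AE y : A y = (msize (y - x0) < r0) :> Prop.
  by rewrite /A /mf_ball /= mf_dist_msize msizeBC.
have AW : A `<=` W by move=> y; rewrite AE; exact: ballW.
have AU : A `<=` U by move=> y /AW /WU.
have openA : open A.
  rewrite openE => z; rewrite AE => Az; apply/nbhs_msizeP.
  exists (r0 - msize (z - x0)); first by rewrite subr_gt0.
  move=> y yz; rewrite AE; have := msizeD (y - z) (z - x0); rewrite subrKA; lra.
have smA : smooth A f := smooth_subset AU smU.
have f_inj x y : A x -> A y -> f x = f y -> x = y.
  move=> /AW Wx /AW Wy xy; apply: (phi_inj gpF NI Wx Wy); by rewrite /= xy.
have open_at z (N : set F) : A z -> nbhs z N -> exists2 eta, 0 < eta &
    forall w, msize w < eta -> exists x, [/\ N x, A x & f x = f z + w].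
  move=> Az nN; have nA : nbhs z A by exact: open_nbhs_nbhs.
  have [d d0 Hd] := (nbhs_msizeP _ _).1 (filterI nN nA).
  have [m [s s0 Hs]] : exists m, exists2 s, 0 < s & forall v, pF m v < s -> msize v < d.
    by case: gpF => _ _; apply.
  have [eta eta0 H] := local_surjectivity gpF mono NI s0
    (fun x h => AW _ (Hd x (Hs _ h)).2).
  exists (c * eta); first exact: mulr_gt0.
  move=> w wc; have [|x xs fx] := H (B0 w).
    by apply: le_lt_trans (B0_bound w) _; rewrite mulrC ltr_pdivrMr// mulrC.
  have [Nx Ax] := Hd x (Hs _ xs); exists x; split => //.
  by rewrite fphi fx (linD linL) -fphi BL.
pose V := f @` A.
have openV : open V.
  rewrite openE => _ [z Az <-]; have [eta eta0 H] := open_at z A Az (open_nbhs_nbhs (conj openA Az)).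
  apply/nbhs_msizeP; exists eta => // y /H[x [_ Ax fx]].
  by exists x => //; rewrite fx subrKC.
pose g y := xget x0 [set x | A x /\ f x = y].
have gK x : A x -> g (f x) = x.
  move=> Ax; rewrite /g; case: xgetP => [y _ [Ay fy]|/(_ x)[]//].
  exact: f_inj fy.
have gA y : V y -> A (g y) by move=> [x Ax <-]; rewrite gK.
have fg y : V y -> f (g y) = y by move=> [x Ax <-]; rewrite gK.
have g_cont y : V y -> g @ y --> g y.
  move=> [z Az <-]; rewrite gK// => N nN; have [eta eta0 H] := open_at z N Az nN.
  apply/nbhs_msizeP; exists eta => // y' /H[x [Nx Ax fx]] /=.
  by rewrite subrKC in fx; rewrite -fx gK.
have /choice[B HB] : forall xw : F * G, exists v, A xw.1 ->
    Dn f xw.1 (fun _ : 'I_1 => v) = xw.2.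
  move=> [x w] /=; have [Ax|nAx] := pselect (A x); last by exists 0.
  have [v vw] := phi1_surj gpF mono NI (B0 w) (AW _ Ax).
  by exists v => _; rewrite -[LHS]BL vw BL.
have lin1 x : A x -> linear (fun v => Dn f x (fun _ : 'I_1 => v)).
  by move=> Ax; exact: (Dn1_linear hf (AU _ Ax)).
have Dn1_inj x v v' : A x ->
    Dn f x (fun _ : 'I_1 => v) = Dn f x (fun _ : 'I_1 => v') -> v = v'.
  move=> Ax vv'; apply/eqP; rewrite -subr_eq0; apply/eqP.
  apply: (phi1_eq0 gpF NI (AW _ Ax)).
  by rewrite (linB (lin1 x Ax)) vv' subrr (lin0 linB0).
have BE x w : A x -> Dn f x (fun _ : 'I_1 => B (x, w)) = w by exact: (HB (x, w)).
exists r0; split; [exact: r00|exact: AU|exact: openV|].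
split; [split|exact: smA|].
- by move=> x Ax; exists x.
- by move=> x y /set_mem Ax /set_mem Ay; exact: f_inj.
- by move=> y.
exists g; first by move=> x /set_mem; exact: gK.
apply: (@smooth_inverse _ _ _ pF pG A f gpF gpG mono openA smA _ (fun x w => B (x, w)) _ _ _ _ _ _ openV gA g_cont).
- by move=> k x Ax; exact: (bsmooth_multilinear hf (AU _ Ax)).
- move=> x Ax a u v; apply: (Dn1_inj x _ _ Ax); rewrite BE// (lin1 x Ax) !BE//.
- by move=> x v Ax; apply: (Dn1_inj x _ _ Ax); rewrite BE.
- by move=> x w Ax; exact: BE.
- move=> S Fl FF X Y x w Ax Xx Yw.
  apply/(cvg_sub0P gpF).
  have nA : \forall s \near Fl, A (X s) by apply: Xx; exact: open_nbhs_nbhs.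
  apply: (phi1_inverse_cvg gpF NI (AW _ Ax) Xx).
    by apply: filterS nA => s /AW.
  have Dc : (fun s => Y s - Dn f (X s) (fun _ : 'I_1 => B (x, w))) @ Fl --> w - w.
    apply: mcvgB => //; rewrite -[X in _ --> X](BE x w Ax).
    by apply: (Dn_cvg openA smA Ax Xx) => i; exact: cvg_cst.
  rewrite subrr in Dc.
  have : (fun s => B0 (Y s - Dn f (X s) (fun _ : 'I_1 => B (x, w)))) @ Fl --> B0 0.
    by apply: cvg_comp Dc _; exact: contB0.
  rewrite (lin0 linB0); apply: mcvg_near; apply: filterS nA => s As.
  by rewrite (linB (lin1 _ As)) BE.
move=> y w Vy; have Ax := gA y Vy.
have yt := @line_cvg _ _ _ y w gpG.
apply: (inverse_derivative gpF NI (AW _ Ax) (w := B0 w)).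
- by rewrite BE.
- exact: (g_cvg g_cont Vy yt).
have nV : \forall t \near (0 : R)^', V (y + t *: w).
  exact: (yt V (open_nbhs_nbhs (conj openV Vy))).
apply: filterS nV => t Vt; split; first exact/AW/gA.
by rewrite /= !fg// (linD linB0) (linZ linB0).
Qed.
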